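(* Let $n \ge 9$ with $n \notin \{14,17\}$. Then an $n$-vertex $K_{1,3}$-induced-saturated graph exists, and $\mathrm{sis}(n,K_{1,3}) = 2n$ if $n \equiv 0 \pmod 3$; $\mathrm{sis}(n,K_{1,3}) = 2n-2$ if $n \equiv 1 \pmod 3$; and $2n \le \mathrm{sis}(n,K_{1,3}) \le 2n+2$ if $n \equiv 2 \pmod 3$.
   Context: All graphs are finite and simple. For a graph $H$, a graph $G$ is $H$-induced-saturated if $G$ contains no induced subgraph isomorphic to $H$, but for every pair of distinct vertices $u,v$ of $G$, the graph obtained from $G$ by adding the edge $uv$ (if $uv\notin E(G)$) or deleting it (if $uv\in E(G)$) contains an induced subgraph isomorphic to $H$. When an $n$-vertex $H$-induced-saturated graph exists, $\mathrm{sis}(n,H)$ denotes the minimum number of edges in an $n$-vertex $H$-induced-saturated graph. *)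

(* Defs.v *)
From HB Require Import structures.
From mathcomp Require Import all_boot.

Set Implicit Arguments.
Unset Strict Implicit.
Unset Printing Implicit Defensive.

Record sgraph (V : finType) := SGraph {
  edges : {set {set V}};
  edges_card2 : edges \subset [set e : {set V} | #|e| == 2] }.

HB.instance Definition _ (V : finType) := [isSub for @edges V].
HB.instance Definition _ (V : finType) := [Finite of sgraph V by <:].

Lemma mk_graph_subproof (V : finType) (E : {set {set V}}) :
  [set e in E | #|e| == 2] \subset [set e : {set V} | #|e| == 2].
Proof. by apply/subsetP=> e; rewrite !inE => /andP[]. Qed.

(* Members of E that are not 2-element sets are discarded. *)
Definition mk_graph (V : finType) (E : {set {set V}}) : sgraph V :=
  SGraph (mk_graph_subproof E).

Definition adj (V : finType) (G : sgraph V) (u v : V) : bool := [set u; v] \in edges G.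

Definition add_edge (V : finType) (G : sgraph V) (u v : V) : sgraph V :=
  mk_graph ([set u; v] |: edges G).

Definition del_edge (V : finType) (G : sgraph V) (u v : V) : sgraph V :=
  mk_graph (edges G :\ [set u; v]).

Definition induced (V : finType) (G : sgraph V) (S : {set V}) :
    sgraph {x : V | x \in S} :=
  mk_graph [set e : {set {x : V | x \in S}} | val @: e \in edges G].

Definition isomorphic (V W : finType) (G : sgraph V) (H : sgraph W) : bool :=
  [exists f : {ffun V -> W},
    [&& injectiveb f, [forall w, w \in codom f]
      & [forall x, forall y, adj H (f x) (f y) == adj G x y]]].

Definition contains_induced (V W : finType) (H : sgraph W) (G : sgraph V) :
    bool :=
  [exists S : {set V}, isomorphic H (induced G S)].

Definition induced_saturated (V W : finType) (H : sgraph W) (G : sgraph V) :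
    bool :=
  ~~ contains_induced H G &&
  [forall u, forall v, (u != v) ==>
    contains_induced H (if adj G u v then del_edge G u v else add_edge G u v)].

(* Every graph on 'I_n has at most 'C(n, 2) edges, so this is the minimum
   whenever a saturated graph exists (see sisP); otherwise it is a junk
   value. *)
Definition sis (n : nat) (W : finType) (H : sgraph W) : nat :=
  \big[minn/'C(n, 2)]_(G : sgraph 'I_n | induced_saturated H G) #|edges G|.

Definition complete_bipartite (m n : nat) : sgraph ('I_m + 'I_n)%type :=
  mk_graph [set [set inl i; inr j] | i in 'I_m, j in 'I_n].

Definition K13 := complete_bipartite 1 3.

Section Adjacency.
Variable V : finType.
Implicit Types (G : sgraph V) (u v x y : V).

Lemma adjC G u v : adj G u v = adj G v u.
Proof. by rewrite /adj setUC. Qed.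

Lemma adjxx G u : adj G u u = false.
Proof.
apply/negP=> /(subsetP (edges_card2 G)).
by rewrite inE setUid cards1.
Qed.

Lemma adj_mk_graph (E : {set {set V}}) u v :
  adj (mk_graph E) u v = ([set u; v] \in E) && (u != v).
Proof. by rewrite /adj inE cards2; case: (u == v). Qed.

Lemma set2_eq (a b u v : V) :
  ([set a; b] == [set u; v]) = ((a == u) && (b == v)) || ((a == v) && (b == u)).
Proof.
apply/eqP/idP=> [E|/orP[]/andP[/eqP-> /eqP->] //]; last exact: setUC.
have := set21 u v; have := set22 u v; rewrite -E !inE !(eq_sym u) !(eq_sym v).
have := set21 a b; have := set22 a b; rewrite E !inE.
by case: (a == u); case: (a == v); case: (b == u); case: (b == v).
Qed.

Lemma adj_add_edge G u v x y :
  u != v ->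
  adj (add_edge G u v) x y =
    [|| (x == u) && (y == v), (x == v) && (y == u) | adj G x y].
Proof.
move=> uv; rewrite adj_mk_graph 2!inE set2_eq -/(adj G x y) orbA.
case: (eqVneq x y) => [<-|_]; rewrite ?andbT // andbF adjxx orbF.
rewrite andbC orbb; apply/esym/negP=> /andP[/eqP-> /eqP vu].
by rewrite vu eqxx in uv.
Qed.

Lemma adj_del_edge G u v x y :
  adj (del_edge G u v) x y =
    ~~ ((x == u) && (y == v) || (x == v) && (y == u)) && adj G x y.
Proof.
rewrite adj_mk_graph 2!inE set2_eq -/(adj G x y).
by case: (eqVneq x y) => [<-|_]; rewrite ?andbT // andbF adjxx andbF.
Qed.

End Adjacency.

Section Containment.
Variables V W : finType.
Implicit Types (G : sgraph V) (H : sgraph W).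

Lemma adj_induced G (S : {set V}) (x y : {x : V | x \in S}) :
  adj (induced G S) x y = adj G (val x) (val y).
Proof.
rewrite /induced adj_mk_graph inE imsetU1 imset_set1 -/(adj _ _ _).
by case: (eqVneq x y) => [<-|_]; rewrite ?andbT // adjxx.
Qed.

Lemma contains_inducedP H G :
  reflect (exists2 f : W -> V, injective f &
             forall x y, adj G (f x) (f y) = adj H x y)
          (contains_induced H G).
Proof.
apply: (iffP existsP) => [[S /existsP[f /and3P[/injectiveP fI _ fA]]]|[f fI fA]].
  exists (fun x => val (f x)) => [x y /val_inj/fI//|x y].
  by rewrite -adj_induced; apply/eqP/(forallP (forallP fA x)).
have fS x : f x \in f @: W by apply: imset_f.
exists (f @: W); apply/existsP.
exists [ffun x => exist (fun v => v \in f @: W) (f x) (fS x)].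
apply/and3P; split.
- by apply/injectiveP=> x y; rewrite !ffunE => /(congr1 val)/fI.
- apply/forallP=> -[v vS]; have /imsetP[x _ vE] := vS.
  by apply/codomP; exists x; apply: val_inj; rewrite ffunE.
- apply/forallP=> x; apply/forallP=> y.
  by rewrite adj_induced !ffunE /= fA.
Qed.

End Containment.

Lemma adj_K13 (x y : 'I_1 + 'I_3) :
  adj K13 x y =
    match x, y with inl _, inr _ | inr _, inl _ => true | _, _ => false end.
Proof.
rewrite adj_mk_graph.
apply/andP/idP => [[/imset2P[i j _ _ /eqP]]|].
  by rewrite set2_eq; case: x y => [a|a] [b|b]; rewrite //= ?andbF.
case: x y => [a|a] [b|b] // _; split=> //; rewrite 1?[[set inr _; _]]setUC;
  exact: imset2_f.
Qed.

Lemma card_edges_le n (G : sgraph 'I_n) : #|edges G| <= 'C(n, 2).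
Proof.
rewrite -[n in 'C(n, _)]card_ord -card_draws.
exact/subset_leq_card/edges_card2.
Qed.

Lemma sisP n (W : finType) (H : sgraph W) :
  (exists G : sgraph 'I_n, induced_saturated H G) ->
  (exists2 G : sgraph 'I_n, induced_saturated H G & #|edges G| = sis n H) /\
  (forall G : sgraph 'I_n, induced_saturated H G -> sis n H <= #|edges G|).
Proof.
case=> G0 satG0.
have le_sis (G : sgraph 'I_n) : induced_saturated H G -> sis n H <= #|edges G|.
  move=> sG; rewrite /sis; move: (index_enum _) (mem_index_enum G).
  elim=> [//|G' r IHr]; rewrite inE big_cons.
  case/predU1P=> [<-|/IHr le_r]; first by rewrite sG geq_minl.
  by case: ifP => // _; rewrite geq_min le_r orbT.
split=> //; case: (arg_minnP (fun G : sgraph 'I_n => #|edges G|) satG0).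
move=> G sG minG; exists G => //; apply/eqP; rewrite eqn_leq le_sis // andbT.
rewrite /sis; elim/big_ind: _ => [|a b Ha Hb|G' /minG //].
  exact: card_edges_le.
by rewrite leq_min Ha.
Qed.

(* Main.v *)
(* For a claw-free graph, saturation under deletion means that every edge uv has
   a common neighbour c with a further neighbour w adjacent to neither u nor
   v: c centers uv. Only vertices of degree at least 4 are centers, and a
   center of two edges at one vertex has degree at least 5.

   Lower bound. Adding an edge between two simplicial vertices creates no claw,
   so these are pairwise adjacent; in particular at most one vertex is
   isolated. A non-simplicial vertex of degree less than 4 (a tip) has degree
   3, and the middle vertex of the path induced on its neighbourhood has
   degree at least 5 and serves no other tip. Moving one unit from that
   vertex to the tip therefore leaves every non-simplicial vertex with charge
   at least 4. If there is no isolated vertex, the few simplicial vertices of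
   small degree are compensated elsewhere and parity gives 2n edges. If there
   is an isolated vertex, the other n - 1 vertices carry at least 4(n - 1); a
   local analysis shows that any tip or vertex of degree at least 5 creates a
   surplus of at least 3, while in the 4-regular case the centered triangles
   partition the edges, which forces 3 | n - 1.

   Upper bound. The line graph of a triangle-free cubic graph is saturated, and
   so are disjoint unions of saturated graphs without simplicial vertices, to
   which one isolated vertex may be added. For n = 2 mod 3 one component is
   the line graph of a graph with 7 vertices and 11 edges. *)

Require Import Defs.
From mathcomp Require Import all_boot.
From mathcomp Require Import zify.

Set Implicit Arguments.
Unset Strict Implicit.
Unset Printing Implicit Defensive.

(** * Claw saturation as a condition on the adjacency relation *)

Section Relations.
Variables (V : finType) (e : rel V).

Definition deg x := #|[set y | e x y]|.

Definition claw c x y z :=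
  [/\ e c x, e c y, e c z & [/\ x <> y, y <> z & x <> z]] /\
  [/\ e x y = false, e y z = false & e x z = false].

Definition centers c u v :=
  [/\ e c u, e c v, e u v &
      exists w, [/\ e c w, e w u = false & e w v = false]].

(** Once the non-edge uv is added, u is the center of a claw with leaves v, a and b. *)
Definition spread u v :=
  exists a b, [/\ e u a, e u b, a <> b, e a b = false
                & e v a = false /\ e v b = false].

Definition simplicial u := forall a b, e u a -> e u b -> a <> b -> e a b.

Record claw_saturated : Prop := ClawSaturated {
  cs_sym : forall x y, e x y = e y x;
  cs_irr : forall x, e x x = false;
  cs_free : forall c x y z, ~ claw c x y z;
  cs_del : forall u v, e u v -> exists c, centers c u v;
  cs_add : forall u v, u <> v -> e u v = false -> spread u v \/ spread v u }.

End Relations.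

Ltac plain :=
  repeat match goal with
  | H : is_true (negb (?x == ?y)) |- _ => move/eqP: H => H
  | H : is_true (?x == ?y) |- _ => move/eqP: H => H
  | H : is_true (negb ?b) |- _ => move/negbTE: H => H
  | H : is_true ?b |- _ => change (b = true) in H
  end.

(** A disequality is proved by substituting the assumed equality and meeting a contradictory pair of
    adjacencies. *)
Ltac rel_done e sym irr :=
  plain; try (intro; plain); unfold is_true; subst;
  first
  [ assumption
  | reflexivity
  | symmetry; assumption
  | rewrite sym; assumption
  | exfalso;
    match goal with
    | H : ?x <> ?x |- _ => exact (H erefl)
    | H : true = false |- _ => discriminate H
    | H : false = true |- _ => discriminate H
    | H : e ?a ?a = true |- _ => rewrite irr in H; discriminate H
    | H : e ?a ?b = true, K : e ?a ?b = false |- _ =>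
        rewrite H in K; discriminate K
    | H : e ?a ?b = true, K : e ?b ?a = false |- _ =>
        rewrite sym H in K; discriminate K
    end ].

Lemma contains_K13P (V : finType) (G : sgraph V) :
  contains_induced K13 G <-> exists c x y z, claw (adj G) c x y z.
Proof.
split=> [/contains_inducedP[f fI fA]|[c [x [y [z]]]]].
  pose o i : 'I_1 + 'I_3 := inr (inord i).
  have oI i j : i < 3 -> j < 3 -> i <> j -> f (o i) <> f (o j).
    by move=> i3 j3 ij /fI[] /(congr1 val) /=; rewrite !inordK.
  exists (f (inl ord0)), (f (o 0)), (f (o 1)), (f (o 2)).
  by split; split; rewrite ?fA ?adj_K13 //; split; apply: oI.
case=> -[cx cy cz [xy yz xz]] [nxy nyz nxz].
apply/contains_inducedP.
pose f (s : 'I_1 + 'I_3) := if s is inr i then nth c [:: x; y; z] i else c.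
have fA s t : adj G (f s) (f t) = adj K13 s t.
  rewrite adj_K13; case: s t => [s|[[|[|[|//]]] ?]] [t|[[|[|[|//]]] ?]] //=;
    by rewrite ?adjxx // adjC.
exists f => // s t.
case: s t => [s|[[|[|[|//]]] ?]] [t|[[|[|[|//]]] ?]]; rewrite /f /= => E;
  try (by rewrite (ord1 s) (ord1 t)); try (by congr inr; apply: val_inj);
  by rel_done (adj G) (@adjC _ G) (@adjxx _ G).
Qed.

Ltac claw_split := split; [split; [| | | split] | split].

Ltac adj_solve G :=
  rewrite ?adj_del_edge ?adj_add_edge //;
  repeat match goal with |- context [?x == ?y] => case: (eqVneq x y) => ? end;
  rewrite /= ?orbT ?andbT ?andbF ?orbF; subst;
  try (by rel_done (adj G) (@adjC _ G) (@adjxx _ G)).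

Ltac adj_done G :=
  by rel_done (adj G) (@adjC _ G) (@adjxx _ G).

Ltac pick_pair key G := match goal with
  | H : is_true (adj G ?t ?q), K : is_true (adj G ?t ?r) |- spread _ ?t ?p =>
      solve [apply: (key p q r t); adj_done G]
  end.

(** A claw that appears when uv is changed must involve that pair: a deleted edge joins two of its
    leaves, an added edge joins its center to a leaf. Its other vertices give [centers] or
    [spread]. *)
Lemma induced_saturatedP (V : finType) (G : sgraph V) :
  induced_saturated K13 G <-> claw_saturated (adj G).
Proof.
split=> [/andP[/negP noclaw /forallP sat]|[_ _ free del add]]; last first.
  apply/andP; split.
    by apply/negP=> /contains_K13P[c [x [y [z]]]]; apply: free.
  apply/forallP=> u; apply/forallP=> v; apply/implyP=> uv.
  apply/contains_K13P; case: ifP => [Auv|Auv].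
    have [c [cu cv _ [w [cw wu wv]]]] := del _ _ Auv.
    exists c, u, v, w; claw_split; adj_solve G.
  case: (add u v (elimN eqP uv) Auv).
    move=> [a [b [ua ub ab nab [va vb]]]].
    by exists u, v, a, b; claw_split; adj_solve G.
  move=> [a [b [ua ub ab nab [va vb]]]].
  by exists v, u, a, b; claw_split; adj_solve G.
have free c x y z : ~ claw (adj G) c x y z.
  by move=> cl; apply/noclaw/contains_K13P; exists c, x, y, z.
split=> //; [exact: adjC|exact: adjxx| |] => u v.
  move=> Auv; have uv : u != v by apply/eqP=> E; rewrite E adjxx in Auv.
  have := forallP (sat u) v; rewrite uv Auv => /contains_K13P.
  move=> [c [x [y [z [[cx cy cz [xy yz xz]] [nxy nyz nxz]]]]]].
  move: cx cy cz nxy nyz nxz; rewrite !adj_del_edge.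
  move=> /andP[_ cx] /andP[_ cy] /andP[_ cz].
  have NE p q : ~~ ((p == u) && (q == v) || (p == v) && (q == u)) && adj G p q
      = false -> adj G p q = false \/ p = u /\ q = v \/ p = v /\ q = u.
    case: (adj G p q); [rewrite andbT => /negbFE /orP|by left].
    by case=> /andP[/eqP-> /eqP->]; right; [left|right].
  move=> /NE[nxy|[[? ?]|[? ?]]] /NE[nyz|[[? ?]|[? ?]]] /NE[nxz|[[? ?]|[? ?]]];
    subst; try congruence;
    try (by exfalso; apply: (free c x y z); claw_split); exists c;
    split=> //; try solve [adj_done G];
    first [ by exists x; split; adj_done G | by exists y; split; adj_done G
          | by exists z; split; adj_done G ].
move=> uv Auv; have uv' : u != v by apply/eqP.
have := forallP (sat u) v; rewrite uv' Auv => /contains_K13P.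
move=> [c [x [y [z [[cx cy cz [xy yz xz]] [nxy nyz nxz]]]]]].
move: cx cy cz nxy nyz nxz; rewrite !adj_add_edge // => cx cy cz.
move=> /norP[_ /norP[_ /negbTE nxy]] /norP[_ /norP[_ /negbTE nyz]].
move=> /norP[_ /norP[_ /negbTE nxz]].
have key p q r t : p <> q -> q <> r -> p <> r -> adj G p q = false ->
    adj G q r = false -> adj G p r = false -> adj G t q -> adj G t r ->
    spread (adj G) t p.
  move=> *; exists q, r; split=> //.
have EX p : [|| (c == u) && (p == v), (c == v) && (p == u) | adj G c p] ->
    [\/ c = u /\ p = v, c = v /\ p = u | adj G c p].
  by case/or3P=> [/andP[/eqP-> /eqP->]|/andP[/eqP-> /eqP->]|];
    [constructor 1|constructor 2|constructor 3].
case: (EX _ cx) (EX _ cy) (EX _ cz) => [[? ?]|[? ?]|{}cx]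
  [[? ?]|[? ?]|{}cy] [[? ?]|[? ?]|{}cz]; subst; try congruence;
  try (by exfalso; apply: (free c x y z); claw_split);
  first [left; pick_pair key G | right; pick_pair key G].
Qed.

(** * Degree sums, and graphs built from relations *)

Lemma sum_deg (V : finType) (G : sgraph V) :
  \sum_x deg (adj G) x = 2 * #|edges G|.
Proof.
have card2 E : E \in edges G -> #|E| = 2.
  by move/(subsetP (edges_card2 G)); rewrite inE => /eqP.
transitivity (\sum_x \sum_(E in edges G) (x \in E)).
  apply: eq_bigr => x _; rewrite -big_mkcondr sum1_card /deg.
  have inj : {in [set y | adj G x y] &, injective (fun y => [set x; y])}.
    move=> y z _ _ /eqP; rewrite set2_eq eqxx /=.
    by case/orP=> [/eqP //|/andP[/eqP-> /eqP->]].
  rewrite -(card_in_imset inj).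
  apply: eq_card => E; rewrite -[RHS]/((E \in edges G) && (x \in E)).
  apply/idP/idP => [/imsetP[y]|/andP[EG xE]].
    by rewrite inE => xy ->; rewrite set21 andbT.
  apply/imsetP.
  have /eqP/cards2P[a [b [ab EE]]] := card2 _ EG.
  subst E; move: xE; rewrite !inE => /orP[]/eqP xE; subst x.
    by exists b; rewrite ?inE.
  by exists a; rewrite ?inE ?[adj G b a]adjC // setUC.
rewrite exchange_big /= mulnC -sum_nat_const; apply: eq_bigr => E EG.
rewrite -[RHS](card2 _ EG) -[RHS]sum1_card [RHS]big_mkcond.
by apply: eq_bigr => x _; case: ifP.
Qed.

Definition graph_of (V : finType) (e : rel V) : sgraph V :=
  mk_graph [set [set p.1; p.2] | p : V * V in [pred p | e p.1 p.2]].

Lemma adj_graph_of (V : finType) (e : rel V) :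
  (forall x y, e x y = e y x) -> (forall x, e x x = false) ->
  adj (graph_of e) =2 e.
Proof.
move=> sym irr x y; rewrite adj_mk_graph; apply/andP/idP.
  move=> [/imsetP[[a b]]]; rewrite inE /= => ab /eqP.
  by rewrite set2_eq => /orP[]/andP[/eqP-> /eqP->] // _; rewrite sym.
move=> xy; split; last by apply/eqP=> E; rewrite E irr in xy.
by apply/imsetP; exists (x, y).
Qed.

(** * Lower bound *)

Section LowerBound.
Variables (V : finType) (e : rel V).
Hypothesis sat : claw_saturated e.

Lemma sym x y : e x y = e y x. Proof. exact: cs_sym. Qed.
Lemma irr x : e x x = false. Proof. exact: cs_irr. Qed.

Ltac cg := by rel_done e sym irr.
Ltac uq :=
  rewrite /= ?inE ?negb_or; do ?(apply/andP; split);
  try (by []); try match goal with |- is_true (_ != _) => apply/eqP end; cg.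
(** Given [N], listing all neighbours of a vertex, splits over the entry that [y] equals and closes
    the cases that contradict known adjacencies. *)
Ltac split_in N y H :=
  let K := fresh in
  pose proof (N y H) as K; simpl in K; decompose [or False] K; clear K;
  try cg.

(** * Neighbourhoods, centers and simplicial vertices *)

Lemma deg_ge l x : uniq l -> all (e x) l -> size l <= deg e x.
Proof.
move=> U /allP A; rewrite /deg cardE; apply: uniq_leq_size => // y /A xy.
by rewrite mem_enum inE.
Qed.

Lemma mem_In (l : seq V) y : y \in l -> List.In y l.
Proof. by elim: l => //= z l IH; rewrite inE => /predU1P[->|/IH]; auto. Qed.

Lemma nb_all l x : uniq l -> all (e x) l -> deg e x <= size l ->
  forall y, e x y -> List.In y l.
Proof.
move=> U /allP A D y xy; apply: mem_In.
have sub : {subset l <= enum [set y | e x y]}.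
  by move=> z /A; rewrite mem_enum inE.
have [_ ->] := uniq_min_size U sub (leq_trans (eq_leq (esym (cardE _))) D).
by rewrite mem_enum inE.
Qed.

Lemma nbs x : exists l, [/\ uniq l, size l = deg e x & forall y,
  e x y = (y \in l)].
Proof.
exists (enum [set y | e x y]); rewrite enum_uniq -cardE.
by split=> // y; rewrite mem_enum inE.
Qed.

Lemma claw_adj c x y z : e c x -> e c y -> e c z -> x <> y -> x <> z ->
  y <> z ->
  e x y = false -> e x z = false -> e y z.
Proof.
move=> cx cy cz xy xz yz nxy nxz; case nyz: (e y z) => //; exfalso.
by apply: (@cs_free _ _ sat c x y z); claw_split.
Qed.

Lemma common_nb c z : e c z -> exists t, e c t /\ e z t.
Proof. by move/(cs_del sat)=> [t [tc tz _ _]]; exists t;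
  rewrite !(sym _ t). Qed.

Lemma centersC c u v : centers e c u v -> centers e c v u.
Proof. by case=> cu cv uv [w [? ? ?]]; split=> //; [rewrite sym|exists w]. Qed.

(** The fourth neighbour is a common neighbour of c and w; as w is adjacent to neither u nor v, it
    is a new vertex. *)
Lemma centers_deg c u v : centers e c u v -> 4 <= deg e c.
Proof.
move=> [cu cv uv [w [cw wu wv]]]; have [t [ct wt]] := common_nb cw.
by apply: (@deg_ge [:: u; v; w; t]); uq.
Qed.

(** Either the two witnesses differ, or the common witness w misses f, x and y, and a common
    neighbour of c and w is the fifth vertex. *)
Lemma centers_two c f x y :
  centers e c f x -> centers e c f y -> x <> y -> 5 <= deg e c.
Proof.
move=> [cf cx fx [w [cw wf wx]]] [_ cy fy [w' [cw' w'f w'y]]] xy.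
have [E|nww] := eqVneq w w'; last by apply: (@deg_ge [:: f; x; y; w; w']); uq.
subst w'; have [t [ct wt]] := common_nb cw.
by apply: (@deg_ge [:: f; x; y; w; t]); uq.
Qed.

Lemma simplicial_adj u v : simplicial e u -> simplicial e v -> u <> v -> e u v.
Proof.
move=> su sv uv; case E: (e u v) => //.
by case: (cs_add sat uv E) => -[a [b [ua ub ab nab _]]];
  [have := su a b ua ub ab|have := sv a b ua ub ab]; cg.
Qed.

Lemma simplicial_center u x y : simplicial e u -> centers e u x y -> False.
Proof.
move=> su [ux uy xy [w [uw wx wy]]].
have xw : e x w by apply: su => //; cg.
cg.
Qed.

(** * Tips and the paths on their neighbourhoods *)

(* The path a - b - c induced on the neighbourhood of a vertex u of degree 3.
   Deleting ua and uc produces w and w', which close up the 5-cycle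
   u - a - w' - w - c inside N(b). *)
Record spike u a b c w w' : Prop := Spike {
  spike_nb : [/\ e u a, e u b & e u c];
  spike_all : forall y, e u y -> List.In y [:: a; b; c];
  spike_path : [/\ e a b, e b c, a <> c & e a c = false];
  spike_w : [/\ e b w, e c w, e w u = false & e w a = false];
  spike_w' : [/\ e b w', e a w', e w' u = false & e w' c = false];
  spike_ww : e w w' }.

Lemma spike_sym u a b c w w' : spike u a b c w w' -> spike u c b a w' w.
Proof.
case=> -[ua ub uc] Nu [ab bc nac ac] [bw cw wu wa] [bw' aw' w'u w'c] ww.
split; try split=> //; try cg.
by move=> y /Nu /= [->|[->|[->|[]]]]; auto.
Qed.

Definition nonsimp u := [exists a, exists b, [&& e u a, e u b, a != b &
  ~~ e a b]].

Lemma nonsimpPn u : ~~ nonsimp u -> simplicial e u.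
Proof.
move=> /existsPn ns a b ua ub ab; have /existsPn/(_ b) := ns a.
by rewrite ua ub /=; have -> : a != b by [apply/eqP]; move/negPn.
Qed.

Lemma nonsimpP u : reflect (~ simplicial e u) (nonsimp u).
Proof.
apply: (iffP idP) => [/existsP[a /existsP[b /and4P[ua ub ab nab]]] s|ns].
  by rewrite (s a b) // in nab; apply/eqP.
by apply: contraT => /nonsimpPn.
Qed.

Definition tip u := (deg e u == 3) && nonsimp u.

(** Only b can center ua and uc. Claw-freeness at b makes each witness adjacent to the far end of
    the path and, because both witnesses miss u, to each other. *)
Lemma path_spike u a b c : (forall y, e u y -> List.In y [:: a; b; c]) ->
  e u a -> e u b -> e u c -> a <> c -> e a c = false -> a <> b -> b <> c ->
  exists w w', spike u a b c w w'.
Proof.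
move=> Nu ua ub uc nac ac nab nbc.
have [t [ut at_]] := common_nb ua; have ab : e a b by split_in Nu t ut.
have [s [us cs]] := common_nb uc; have bc : e b c by split_in Nu s us.
have [x [xu xa _ [w [xw wu wa]]]] := cs_del sat ua.
have ux : e u x by cg.
have ? : x = b by split_in Nu x ux.
subst x.
have [y [yu yc _ [w' [yw wu' wc']]]] := cs_del sat uc.
have uy : e u y by cg.
have ? : y = b by split_in Nu y uy.
subst y.
have cw : e c w by apply: (@claw_adj b a); cg.
have aw : e a w' by apply: (@claw_adj b c); cg.
have ww : e w w' by apply: (@claw_adj b u); cg.
by exists w, w'; split.
Qed.

Lemma tip_spike u : tip u -> exists a b c w w', spike u a b c w w'.
Proof.
move=> /andP[/eqP D3 /existsP[a /existsP[c /and4P[ua uc nac ac]]]].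
have [t [ut at_]] := common_nb ua.
have Nu : forall y, e u y -> List.In y [:: a; t; c].
  by apply: nb_all; rewrite ?D3 //; uq.
have [||||w [w' sp]] := path_spike Nu ua ut uc; try cg.
by exists a, t, c, w, w'.
Qed.

Lemma spike_tip u a b c w w' : spike u a b c w w' -> tip u.
Proof.
case=> -[ua ub uc] Nu [ab bc nac ac] _ _ _; apply/andP; split; last first.
  by apply/existsP; exists a; apply/existsP; exists c; apply/and4P; split=> //;
    [apply/eqP|rewrite ac].
rewrite eqn_leq (@deg_ge [:: a; b; c]) ?andbT; [|uq|uq].
rewrite /deg; apply: leq_trans (card_size [:: a; b; c]).
apply: subset_leq_card; apply/subsetP => y; rewrite inE => uy.
by rewrite !inE; split_in Nu y uy; subst y; rewrite eqxx ?orbT.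
Qed.

Lemma spike_deg_mid u a b c w w' : spike u a b c w w' -> 5 <= deg e b.
Proof.
case=> -[ua ub uc] Nu [ab bc nac ac] [bw cw wu wa] [bw' aw' w'u w'c] ww.
by apply: (@deg_ge [:: u; a; c; w; w']); uq.
Qed.

(** If a had only the neighbours u, b and w', adding uw' would create no claw: at u the ends a and c
    would both be needed, but a is adjacent to w'; at w' two suitable leaves would already form a
    claw with a. *)
Lemma spike_deg_end u a b c w w' : spike u a b c w w' -> 4 <= deg e a.
Proof.
case=> -[ua ub uc] Nu [ab bc nac ac] [bw cw wu wa] [bw' aw' w'u w'c] ww.
rewrite leqNgt; apply/negP => D.
have Na : forall y, e a y -> List.In y [:: u; b; w'].
  by apply: nb_all => //; uq.
have uw : u <> w' by cg.
have nuw : e u w' = false by cg.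
case: (cs_add sat uw nuw) => -[p [r [xp xr pr npr [yp yr]]]].
  by split_in Nu p xp; split_in Nu r xr.
have ap : e a p = false by apply/negP=> ap; split_in Na p ap.
have ar : e a r = false by apply/negP=> ar; split_in Na r ar.
have prA : e p r by apply: (@claw_adj w' a); cg.
cg.
Qed.

(** If u1 is not adjacent to u, claw-freeness at b makes it adjacent to the adjacent vertices w and
    w'; these would be the two nonadjacent ends of the path at u1. A neighbour of u on its path has
    degree at least 4. The case that u1 is w or w' is excluded first. *)
Lemma mid_uniq u a b c w w' u1 a1 c1 w1 w1' :
  spike u a b c w w' -> spike u1 a1 b c1 w1 w1' -> u = u1.
Proof.
move=> sp sp1; case: (u =P u1) => // nuu; exfalso.
have /andP[/eqP D1 _] := spike_tip sp1; have /andP[/eqP D _] := spike_tip sp.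
have Da := spike_deg_end sp; have Dc := spike_deg_end (spike_sym sp).
(* If u1 were q, then u and u1 would be the only common neighbours of x and b, and degree 3 is too
   small for a center of xb. *)
have wlog_w' x y p q : spike u x b y p q -> u1 <> q.
  case=> -[ux ub uy] Nu [xb b_y nxy xy] [bp yp pu px] [bq xq qu qy] pq E.
  subst q.
  have N1 : forall z, e u1 z -> List.In z [:: x; b; p].
    by apply: nb_all; rewrite ?D1 //; uq.
  have Nb z : e b z -> e x z -> z = u \/ z = u1.
    move=> bz xz; case: (z =P u) => [|zu]; [by left|right].
    case: (z =P u1) => // zu1.
    have uz : e u z = false by apply/negP => uz; split_in Nu z uz.
    have u1z : e u1 z by apply: (@claw_adj b u); cg.
    by split_in N1 z u1z.
  have [z zc] := cs_del sat xb; have := centers_deg zc.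
  case: zc => zx zb _ _.
  have [||->|->] := Nb z; [cg|cg|by rewrite D|by rewrite D1].
have n1 := wlog_w' _ _ _ _ sp; have n2 := wlog_w' _ _ _ _ (spike_sym sp).
case: sp sp1 => -[ua ub uc] Nu [ab bc nac ac] [bw cw wu wa] [bw' aw' w'u w'c]
  ww.
case=> -[ua1 ub1 uc1] Nu1 [ab1 bc1 nac1 ac1] _ _ _.
case uu1: (e u u1).
  by split_in Nu u1 uu1; subst u1; rewrite D1 in Da, Dc.
have uw : e u1 w by apply: (@claw_adj b u); cg.
have uw' : e u1 w' by apply: (@claw_adj b u); cg.
by split_in Nu1 w uw; split_in Nu1 w' uw'.
Qed.

Lemma pent_all u a b c w w' : spike u a b c w w' -> deg e b = 5 ->
  forall y, e b y -> List.In y [:: u; a; c; w; w'].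
Proof.
case=> -[ua ub uc] Nu [ab bc nac ac] [bw cw wu wa] [bw' aw' w'u w'c] ww D.
by apply: nb_all; rewrite ?D //; uq.
Qed.

(** Here N(b) is the 5-cycle u - a - w' - w - c, so only u or w' could center ab, and u has degree
    3. For bw the other candidate is c, but its witness would be a fourth neighbour of u. *)
Lemma pent_centers u a b c w w' : spike u a b c w w' -> deg e b = 5 ->
  centers e w' b a /\ centers e w' b w.
Proof.
move=> sp D; have Nb := pent_all sp D.
have /andP[/eqP Du _] := spike_tip sp.
case: sp => -[ua ub uc] Nu [ab bc nac ac] [bw cw wu wa] [bw' aw' w'u w'c] ww.
split.
  have [z zc] := cs_del sat ab; have Dz := centers_deg zc.
  have [za zb _ _] := zc; have bz : e b z by cg.
  split_in Nb z bz; first by subst z; rewrite Du in Dz.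
  by subst z; apply: centersC.
have [z zc] := cs_del sat bw; have [zb zw _ [y [zy yb yw]]] := zc.
have bz : e b z by cg.
split_in Nb z bz.
subst z; exfalso.
have uy : e u y by apply: (@claw_adj c w); cg.
by split_in Nu y uy.
Qed.

(** * Discharging from midpoints to tips *)

(** Read off from N(u) alone, so that pairs of a tip and its midpoint can be counted; for a tip this
    is the vertex b of its [spike]. *)
Definition midpoint u b := e u b && [forall x, e u x && (x != b) ==> e b x].
Definition mid b := [exists u, tip u && midpoint u b].

Lemma spike_midpoint u a b c w w' b' : spike u a b c w w' ->
  midpoint u b' = (b' == b).
Proof.
case=> -[ua ub uc] Nu [ab bc nac ac] _ _ _; apply/idP/eqP => [|->].
  case/andP => ub' /forallP all_b'; split_in Nu b' ub'; subst b'.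
    by have := all_b' c; rewrite uc ac implybF /= negbK => /eqP; cg.
  by have := all_b' a; rewrite ua sym ac implybF /= negbK => /eqP; cg.
rewrite /midpoint ub; apply/forallP => x; apply/implyP => /andP[ux xb].
by split_in Nu x ux.
Qed.

Lemma mid_spike b : mid b -> exists u a c w w', spike u a b c w w'.
Proof.
move=> /existsP[u /andP[/tip_spike[a [b' [c [w [w' sp]]]]] ub]].
move: ub; rewrite (spike_midpoint _ sp) => /eqP ->.
by exists u, a, c, w, w'.
Qed.

(** Double counting of the pairs of a tip and its midpoint: each tip has one midpoint, and by
    [mid_uniq] each midpoint serves one tip. *)
Lemma sum_tip_mid : \sum_v tip v = \sum_v mid v.
Proof.
transitivity (\sum_u \sum_b (tip u && midpoint u b)).
  apply: eq_bigr => u _; case Tu: (tip u); last by rewrite big1.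
  have [a [b [c [w [w' sp]]]]] := tip_spike Tu.
  rewrite (bigD1 b) //= (spike_midpoint _ sp) eqxx big1 // => b' /negbTE bb.
  by rewrite (spike_midpoint _ sp) bb.
rewrite exchange_big; apply: eq_bigr => b _; case Mb: (mid b); last first.
  rewrite big1 // => u _; apply/eqP; rewrite eqb0; apply/negP => ub.
  by case/negP: (negbT Mb); apply/existsP; exists u.
have [u [a [c [w [w' sp]]]]] := mid_spike Mb.
rewrite (bigD1 u) //= (spike_tip sp) (spike_midpoint _ sp) eqxx big1 //.
move=> u1 u1u; apply/eqP; rewrite eqb0; apply/negP => /andP[].
move=> /tip_spike[a1 [b1 [c1 [w1 [w1' sp1]]]]].
rewrite (spike_midpoint _ sp1) => /eqP E; subst b1.
by rewrite (mid_uniq sp sp1) eqxx in u1u.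
Qed.

(* Every tip takes one unit of degree from the middle of its neighbourhood; by
   [mid_uniq] no vertex gives away more than one unit. *)
Definition charge v := deg e v + tip v - mid v.

Lemma mid_deg b : mid b -> 5 <= deg e b.
Proof. by case/mid_spike=> u [a [c [w [w' /spike_deg_mid]]]]. Qed.

Lemma sum_charge : \sum_v charge v = \sum_v deg e v.
Proof.
have : \sum_v charge v + \sum_v mid v = \sum_v deg e v + \sum_v tip v.
  rewrite -!big_split /=; apply: eq_bigr => v _; rewrite /charge subnK //.
  by case M: (mid v) => //; have := mid_deg M; lia.
by rewrite sum_tip_mid; lia.
Qed.

Lemma charge_big v : 4 <= deg e v -> charge v = deg e v - mid v.
Proof.
by move=> D; rewrite /charge /tip; case: eqP => [E|_];
  [rewrite E in D|rewrite addn0].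
Qed.

Lemma charge_small v : deg e v < 5 -> charge v = deg e v + tip v.
Proof.
move=> D; rewrite /charge; case M: (mid v); last by rewrite subn0.
by have := mid_deg M; lia.
Qed.

Lemma charge_ge4 v : 4 <= deg e v -> 4 <= charge v.
Proof.
move=> D; rewrite charge_big //; case M: (mid v); last by rewrite subn0.
by have := mid_deg M; lia.
Qed.

Lemma charge_gt v m : 3 < m < deg e v -> m <= charge v.
Proof.
by move=> /andP[m4 D]; rewrite charge_big; [case: (mid v); lia|lia].
Qed.

Lemma charge_nonmid v : 4 <= deg e v -> ~~ mid v -> charge v = deg e v.
Proof. by move=> D /negbTE M; rewrite charge_big // M subn0. Qed.

Lemma nonsimp_deg v : nonsimp v -> 3 <= deg e v.
Proof.
move=> /existsP[a /existsP[b /and4P[va vb ab nab]]].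
have [t [vt at_]] := common_nb va.
by apply: (@deg_ge [:: a; b; t]); uq.
Qed.

Lemma nonsimp_charge v : nonsimp v -> 4 <= charge v.
Proof.
move=> N; have := nonsimp_deg N; case: (ltnP 3 (deg e v)) => [D _|D D'].
  exact: charge_ge4.
by rewrite charge_small /tip ?N; lia.
Qed.

(** * Vertices with surplus charge *)

(** The witnesses y and z for the two edges centered by w' bring its degree to at least 5. Were it 5
    with w' a midpoint, its tip would be one of the five known neighbours, and each of these is
    excluded. *)
Lemma pent_charge u a b c w w' : spike u a b c w w' -> deg e b = 5 ->
  5 <= charge w'.
Proof.
move=> sp Db; have Nb := pent_all sp Db; have sp' := spike_sym sp.
have [ca cw_] := pent_centers sp Db.
have [cc cw'] := pent_centers sp' Db.
have Dmid := spike_deg_mid sp; have Tu := spike_tip sp.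
case: sp => -[ua ub uc] Nu [ab bc nac ac] [bw cw wu wa] [bw' aw' w'u w'c] ww.
case: ca => _ _ _ [y [wy yb ya]]; case: cw_ => _ _ _ [z [wz zb zw]].
case: cc => _ _ _ [y' [wy' y'b y'c]]; case: cw' => _ _ _ [z' [wz' z'b z'w]].
have za : e z a by apply: (@claw_adj w' w); cg.
have yw : e y w by apply: (@claw_adj w' a); cg.
have z'c : e z' c by apply: (@claw_adj w w'); cg.
have y'w' : e y' w' by apply: (@claw_adj w c); cg.
have yz : e y z by apply: (@claw_adj w' b); cg.
have D : 5 <= deg e w' by apply: (@deg_ge [:: a; b; w; y; z]); uq.
have D2 : 5 <= deg e w by apply: (@deg_ge [:: c; b; w'; y'; z']); uq.
case: (ltnP 5 (deg e w')) => [D'|D']; first exact: charge_gt.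
case M: (mid w'); last by rewrite charge_nonmid ?M // (leq_trans _ D).
exfalso; have [t [a1 [c1 [w1 [w1' spt]]]]] := mid_spike M.
have /andP[/eqP Dt _] := spike_tip spt.
have N : forall x, e w' x -> List.In x [:: a; b; w; y; z].
  by apply: nb_all => //; uq.
have Da : 4 <= deg e a by apply: (@deg_ge [:: u; b; w'; z]); uq.
have wt : e w' t by case: (spt) => -[]; rewrite (sym t w').
split_in N t wt; subst t.
- by rewrite Dt in Da.
- by rewrite Dt in Dmid.
- by rewrite Dt in D2.
  (* The tip would be y, but y is also a witness at w and so gains a fourth neighbour. *)
  have E : y' = y by split_in N y' (etrans (sym _ _) y'w').
  subst y'; have yz' : e y z' by apply: (@claw_adj w b); cg.
  have : 4 <= deg e y by apply: (@deg_ge [:: w'; w; z; z']); uq.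
  by rewrite Dt.
(* The tip would be z, and then adding uz creates no claw. *)
have Nz : forall x, e z x -> List.In x [:: a; w'; y].
  by apply: nb_all; rewrite ?Dt //; uq.
have uz : u <> z by cg.
have nuz : e u z = false by apply/negP => uz_; split_in Nu z uz_.
case: (cs_add sat uz nuz) => -[p [r [xp xr pr npr [yp yr]]]].
  by split_in Nu p xp; split_in Nu r xr.
by split_in Nz p xp; split_in Nz r xr.
Qed.

(** Take d as a center of vc. It misses u, so it is adjacent to the witnesses of both given centers
    and has degree at least 5. If it were a midpoint of degree 5, then by [pent_centers] one of v
    and c would center the edge from d to the other, which claw-freeness at v and c forbids. *)
Lemma mutual_extra u v c : simplicial e u -> centers e v u c ->
  centers e c u v ->
  (forall s, e u s -> s <> v -> s <> c -> simplicial e s) ->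
  exists d, 5 <= charge d.
Proof.
move=> su vc cv rest.
have Dv := centers_deg vc; have Dc := centers_deg cv.
case: (vc) => vu _ uc [x [vx xu xc]]; case: (cv) => cu cv_ uv [w [cw wu wv]].
have vcA : e v c by cg.
have [d dvc] := cs_del sat vcA; case: (dvc) => dv dc _ [y [dy yv yc]].
have ud : e u d = false.
  apply/negP => ud; apply: (@simplicial_center d v c) => //.
  by apply: rest => //; cg.
have ud' : u <> d by move=> E; subst d; apply: (simplicial_center su dvc).
have dx : e d x by apply: (@claw_adj v u); cg.
have dw : e d w by apply: (@claw_adj c u); cg.
have D : 5 <= deg e d by apply: (@deg_ge [:: v; c; x; w; y]); uq.
have clq z : e u z -> e v z \/ z = v.
  by move=> uz; case: (v =P z) => [->|vz]; [right|left; apply: su; cg].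
have clqc z : e u z -> e c z \/ z = c.
  by move=> uz; case: (c =P z) => [->|vz]; [right|left; apply: su; cg].
have ncv : ~ centers e c d v.
  case=> _ _ _ [z [cz zd zv]].
  have uz : e u z = false by apply/negP => /clq[]; cg.
  have dz : e d z by apply: (@claw_adj c u); cg.
  cg.
have nvc : ~ centers e v d c.
  case=> _ _ _ [z [vz zd zc]].
  have uz : e u z = false by apply/negP => /clqc[]; cg.
  have dz : e d z by apply: (@claw_adj v u); cg.
  cg.
exists d; case: (ltnP 5 (deg e d)) => [D'|D']; first exact: charge_gt.
case M: (mid d); last by rewrite charge_nonmid ?M // (leq_trans _ D).
have {}D : deg e d = 5 by apply/eqP; rewrite eqn_leq D D'.
have [t [a1 [c1 [w1 [w1' sp]]]]] := mid_spike M.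
have N := pent_all sp D; have [ca cw1] := pent_centers sp D.
have [cc cw1'] := pent_centers (spike_sym sp) D.
have /andP[/eqP Dt _] := spike_tip sp.
case: (sp) => -[ta tb tc] Nu [ab bc nac ac] [bw1 cw1_ wt wa] [bw1' aw1' w't
  w'c] ww.
have dv' : e d v by cg.
have dc' : e d c by cg.
exfalso; split_in N v dv'; subst v; try (by rewrite Dt in Dv);
  split_in N c dc'; subst c; try (by rewrite Dt in Dc).
all: by [case: ncv|case: nvc].
Qed.

Lemma fresh_nb (l : seq V) x : size l < deg e x ->
  exists2 y, e x y & y \notin l.
Proof.
have [l' [U <- N]] := nbs x; move=> lt.
have /allPn[y yl' yl] : ~~ all (mem l) l'.
  by apply/negP => /allP sub; have := uniq_leq_size U sub; rewrite leqNgt lt.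
by exists y; rewrite ?N.
Qed.

(* The charges exceed 4 by at least 3 in total (x, y, z may coincide). *)
Definition excess3 := exists x y z, forall v,
  (v == x) + (v == y) + (v == z) <= charge v - 4.

Lemma excess111 x y z : x <> y -> y <> z -> x <> z ->
  5 <= charge x -> 5 <= charge y -> 5 <= charge z -> excess3.
Proof.
move=> xy yz xz cx cy cz; exists x, y, z => v.
by case: eqP => [E|_]; case: eqP => [E'|_]; case: eqP => [E''|_]; subst => //=;
  lia.
Qed.

Lemma excess21 x y : x <> y -> 6 <= charge x -> 5 <= charge y -> excess3.
Proof.
move=> xy cx cy; exists x, x, y => v.
by case: eqP => [E|_]; case: eqP => [E'|_]; subst => //=; lia.
Qed.

(** N(b) is an induced 5-cycle. *)
Lemma pent_no_triangle u a b c w w' x y z : spike u a b c w w' -> deg e b = 5 ->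
  e b x -> e b y -> e b z -> e x y -> e y z -> e x z -> False.
Proof.
move=> sp Db bx b_y bz xy yz xz; have Nb := pent_all sp Db.
case: sp => -[ua ub uc] Nu [ab bc nac ac] [bw cw wu wa] [bw' aw' w'u w'c] ww.
by split_in Nb x bx; split_in Nb y b_y; split_in Nb z bz.
Qed.

Lemma spike_nonnb_adj u a b c w w' x y : spike u a b c w w' ->
  e b x -> e b y -> e u x = false -> e u y = false -> x <> u -> y <> u ->
  x <> y -> e x y.
Proof.
by move=> /spike_nb[_ ub _] bx b_y ux uy xu yu xy; apply: (@claw_adj b u); cg.
Qed.

Lemma spike_end_center u a b c w w' : spike u a b c w w' ->
  exists q y, [/\ e b q, e a q & e u q = false]
    /\ [/\ q <> u, e q y, e y a = false & e y b = false].
Proof.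
move=> sp; have /andP[/eqP Du _] := spike_tip sp.
case: sp => -[ua ub uc] Nu [ab bc nac ac] _ _ _.
have [q qc] := cs_del sat ab; have Dq := centers_deg qc.
case: qc => qa qb _ [y [qy ya yb]]; exists q, y; split; split=> //; try cg.
  by apply/negP => uq_; split_in Nu q uq_.
by move=> E; rewrite E Du in Dq.
Qed.

(** The neighbours of b outside N[u] form a clique of at least three vertices, which contains a
    center qa of ab and a center qc of cb. If these coincide, that vertex has degree at least 7;
    otherwise each has degree at least 5 and, with a triangle in its neighbourhood, is no midpoint
    of degree 5. *)
Lemma big_mid_excess u a b c w w' : spike u a b c w w' -> 6 <= deg e b ->
  excess3.
Proof.
move=> sp Db; have cb : 5 <= charge b by exact: charge_gt.
have adjQ := spike_nonnb_adj sp.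
have [qa [y [[bqa aqa uqa] [nqa qy ya yb]]]] := spike_end_center sp.
have [qc [y' [[bqc cqc uqc] [nqc qy' y'c y'b]]]] :=
  spike_end_center (spike_sym sp).
case: (sp) => -[ua ub uc] Nu [ab bc nac ac] [bw cw wu wa] [bw' aw' w'u w'c] ww.
have [q bq] := @fresh_nb [:: u; a; c; w; w'] b Db.
rewrite !inE !negb_or => /and5P[/eqP qu /eqP q_a /eqP q_c /eqP qw /eqP qw'].
have uq : e u q = false by apply/negP => uq_; split_in Nu q uq_.
have two s : e b s -> e u s = false -> s <> u ->
    exists p r, [/\ e b p, e b r, p <> r & [/\ e u p = false, e u r = false,
      e s p, e s r & e p r]].
  move=> bs us su.
  case: (s =P w) => [E|sw].
    subst s; exists w', q; split; try cg; split; try cg; apply: adjQ; cg.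
  case: (s =P w') => [E|sw'].
    subst s; exists w, q; split; try cg; split; try cg; apply: adjQ; cg.
  exists w, w'; split; try cg; split; try cg; apply: adjQ; cg.
have [|||p [r [bp br pr [up ur qap qar prA]]]] := two qa; try cg.
have [E|ne] := eqVneq qa qc.
  subst qc; have yy' : y <> y'.
    move=> E; subst y'; have : e c y by apply: (@claw_adj qa a); cg.
    by move=> ?; cg.
  apply: (@excess21 qa b); [cg| |done]; apply: charge_gt => /=.
  by apply: (@deg_ge [:: a; c; b; p; r; y; y']); uq.
have chg s x p' r' y0 : e b s -> e s x -> e u x -> e u p' = false ->
  e u r' = false ->
    e s p' -> e s r' -> e p' r' -> e b p' -> e b r' -> e b x -> e s y0 ->
    e y0 x = false -> e y0 b = false -> p' <> r' -> 5 <= charge s.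
  move=> bs sx ux up' ur' sp' sr' pr' bp' br' bx sy y0x y0b np'r'.
  have D : 5 <= deg e s by apply: (@deg_ge [:: b; x; p'; r'; y0]); uq.
  case: (ltnP 5 (deg e s)) => [D'|D']; first exact: charge_gt.
  case M: (mid s); last by rewrite charge_nonmid ?M // (leq_trans _ D).
  have {}D : deg e s = 5 by apply/eqP; rewrite eqn_leq D D'.
  have [t [a1 [c1 [w1 [w1' sp1]]]]] := mid_spike M.
  by case: (pent_no_triangle sp1 D _ sp' sr' bp' pr' br'); cg.
have [|||p' [r' [bp' br' pr' [up' ur' qcp qcr prA']]]] := two qc; try cg.
apply: (@excess111 b qa qc); try cg; try done.
  by apply: (@chg qa a p r y); cg.
by apply: (@chg qc c p' r' y'); cg.
Qed.

(** Both w and w' have surplus. A third unit comes from an end of degree at least 5, directly or, if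
    that end is a midpoint of degree 5, from its own two witnesses. If both ends have degree 4,
    adding ac creates no claw. *)
Lemma pent_excess u a b c w w' : spike u a b c w w' -> deg e b = 5 -> excess3.
Proof.
move=> sp Db; have cw' := pent_charge sp Db; have cw :=
  pent_charge (spike_sym sp) Db.
have big a' w1 w1' c' : spike u a' b c' w1 w1' -> 5 <= charge w1 ->
  5 <= charge w1' ->
    5 <= deg e a' -> excess3.
  move=> sp' c1 c1' D.
  case: (sp') => -[ua ub uc] Nu [ab bc nac ac] [bw cw_ wu wa] [bw' aw' w'u w'c]
    ww.
  case: (leqP 5 (charge a')) => [ca|ca].
    by apply: (@excess111 a' w1 w1'); cg.
  have D' : deg e a' = 5.
    by apply/eqP; rewrite eqn_leq D andbT leqNgt; apply/negP => D';
      rewrite ltnNge charge_gt in ca.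
  have M : mid a'.
    by apply: contraT => M;
      rewrite charge_nonmid // ?(leq_trans _ D) // ltnNge D in ca.
  have [t [a2 [c2 [w2 [w2' sp2]]]]] := mid_spike M.
  have c2w := pent_charge (spike_sym sp2) D'; have c2w' := pent_charge sp2 D'.
  case: sp2 => _ _ _ [aw2 _ _ _] [aw2' _ _ _] ww2.
  (* [w1] misses the end [a'], while [w2] and [w2'] are adjacent to it, so the three are
     distinct. *)
  by apply: (@excess111 w1 w2 w2'); cg.
case: (leqP 5 (deg e a)) => [Da|Da]; first exact: (big a w w' c).
case: (leqP 5 (deg e c)) => [Dc|Dc]; first exact: (big c w' w a (spike_sym sp)).
exfalso.
have [_ [_ _ _ [z [wz zb zw]]]] := pent_centers sp Db.
have [_ [_ _ _ [z' [wz' z'b z'w]]]] := pent_centers (spike_sym sp) Db.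
case: sp => -[ua ub uc] Nu [ab bc nac ac] [bw cw_ wu wa] [bw' aw' w'u w'c] ww.
have za : e z a by apply: (@claw_adj w' w); cg.
have z'c : e z' c by apply: (@claw_adj w w'); cg.
have Na : forall x, e a x -> List.In x [:: u; b; w'; z].
  by apply: nb_all => //; uq.
have Nc : forall x, e c x -> List.In x [:: u; b; w; z'].
  by apply: nb_all => //; uq.
case: (cs_add sat nac ac) => -[p [r [xp xr pr npr [yp yr]]]].
  by split_in Na p xp; split_in Na r xr.
by split_in Nc p xp; split_in Nc r xr.
Qed.

Lemma tip_excess u : tip u -> excess3.
Proof.
move=> /tip_spike[a [b [c [w [w' sp]]]]]; have := spike_deg_mid sp.
rewrite leq_eqVlt => /predU1P[D|D]; first exact: (pent_excess sp (esym D)).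
exact: (big_mid_excess sp).
Qed.

(** * Vertices of degree at least 5 whose neighbours are small *)

Lemma centers_nb c f x y : centers e c f y -> centers e c f x ->
  deg e c <= 4 -> x = y.
Proof.
move=> cy cx D; case: (x =P y) => // xy.
by have := centers_two cx cy xy; rewrite leqNgt ltnS D.
Qed.

(* With all degrees in N(f) at most 4, a vertex centers at most one of the edges
   at f, so the centers of these edges form a permutation of N(f). *)
Lemma neighbour_centers f : (forall y, e f y -> deg e y <= 4) ->
  (forall c, e f c -> exists x, centers e c f x) /\
  (forall c c' x, centers e c f x -> centers e c' f x -> c = c').
Proof.
move=> D4.
have [g gP] : exists g, forall x, e f x -> centers e (g x) f x.
  apply: (@fin_all_exists V (fun=> V) (fun x c => e f x ->
    centers e c f x)) => x.
  by case fx: (e f x); [have [c] := cs_del sat fx; exists c|exists x].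
pose N := [set y | e f y].
have cN c x : centers e c f x -> c \in N by case=> cf _ _ _; rewrite inE sym.
have gI : {in N &, injective g}.
  move=> x y; rewrite !inE => fx fy E.
  have cx := gP _ fx; have cy := gP _ fy; rewrite -E in cy.
  by apply: (centers_nb cy cx); apply: D4; have := cN _ _ cx; rewrite inE.
have gN : g @: N = N.
  apply/eqP; rewrite eqEcard card_in_imset // leqnn andbT.
  by apply/subsetP => _ /imsetP[x xN ->]; apply: cN (gP x _); rewrite inE in xN.
have gE c x : centers e c f x -> c = g x.
  move=> cx; have := cN _ _ cx; rewrite -{1}gN => /imsetP[y]; rewrite inE =>
    fy E.
  rewrite E in cx *; congr g; apply: (centers_nb cx (gP _ fy)).
  by apply: D4; have := cN _ _ cx; rewrite inE.
split=> [c fc|c c' x cx cx']; last by rewrite (gE _ _ cx) (gE _ _ cx').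
have : c \in g @: N by rewrite gN inE.
by case/imsetP=> x; rewrite inE => /gP cx ->; exists x.
Qed.

(** The witness z at y1 has a common neighbour with y1, which can only be y3; this fills N(y3) and
    leaves no witness there. *)
Lemma triangle_turn f y1 y2 y3 : e f y1 -> e f y2 -> e f y3 ->
  e y1 y2 -> e y2 y3 -> e y1 y3 -> deg e y1 <= 4 -> deg e y3 <= 4 ->
  centers e y1 f y2 -> centers e y3 f y1 -> False.
Proof.
move=> f1 f2 f3 e12 e23 e13 D1 D3 [_ _ _ [z [z1 zf z2]]] [_ _ _ [z' [z3 z'f
  z'1]]].
have N1 : forall y, e y1 y -> List.In y [:: f; y2; y3; z].
  by apply: nb_all => //; uq.
have [t [t1 zt]] := common_nb z1.
split_in N1 t t1; subst t.
have N3 : forall y, e y3 y -> List.In y [:: f; y1; y2; z].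
  by apply: nb_all => //; uq.
by split_in N3 z' z3.
Qed.

(** The edge from f to each triangle vertex is centered by another triangle vertex, and none centers
    two of them. So the centers rotate the triangle, against [triangle_turn]. *)
Lemma triangle_centers f y1 y2 y3 : e f y1 -> e f y2 -> e f y3 ->
  e y1 y2 -> e y2 y3 -> e y1 y3 ->
  deg e y1 <= 4 -> deg e y2 <= 4 -> deg e y3 <= 4 ->
  centers e y2 f y1 \/ centers e y3 f y1 ->
  centers e y1 f y2 \/ centers e y3 f y2 ->
  centers e y1 f y3 \/ centers e y2 f y3 -> False.
Proof.
move=> f1 f2 f3 e12 e23 e13 D1 D2 D3.
have two y x x' : deg e y <= 4 -> x <> x' -> centers e y f x ->
    centers e y f x' -> False.
  by move=> D xx cx cx'; apply: xx; apply: (centers_nb cx' cx).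
have n13 : y1 <> y3 by cg.
have n12 : y1 <> y2 by cg.
have n23 : y2 <> y3 by cg.
case=> [c21|c31] [c12|c32] [c13|c23].
- exact: (two y1 y2 y3).
- exact: (two y2 y1 y3).
- by apply: (@triangle_turn f y2 y1 y3); cg.
- exact: (two y2 y1 y3).
- exact: (two y1 y2 y3).
- by apply: (@triangle_turn f y1 y2 y3); cg.
- exact: (two y3 y1 y2).
- exact: (two y3 y1 y2).
Qed.

(** N(f) has maximum degree at most 2 and no triangle, while the non-neighbours of a vertex within
    N(f) form a clique. Only the 5-cycle remains, and there the centers cannot be assigned. *)
Lemma lonely_absurd f : 5 <= deg e f -> (forall y, e f y -> deg e y <= 4) ->
  False.
Proof.
move=> Df D4; have [cen cuniq] := neighbour_centers D4.
(* Every neighbour c of f centers an edge at f, so it has a neighbour z outside N(f) and room for at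
   most two neighbours inside. *)
have cform c : e f c -> exists x z t, [/\ centers e c f x, e f x, e c x,
    e f z = false & [/\ c <> t, t <> x, e c t & forall y, e c y ->
      List.In y [:: f; x; z; t]]].
  move=> fc; have [x cx] := cen _ fc; have D := D4 _ fc.
  case: (cx) => cf cx_ fx [z [cz zf zx]]; have [t [ct zt]] := common_nb cz.
  exists x, z, t; split; try cg; split; try cg; apply: nb_all => //; uq.
have F3 c p q r : e f c -> e f p -> e f q -> e f r -> e c p -> e c q -> e c r ->
    p <> q -> q <> r -> p <> r -> False.
  move=> fc fp fq fr cp cq cr pq qr pr.
  have [x [z [t [_ fx cx fz [_ _ _ N]]]]] := cform _ fc.
  by split_in N p cp; split_in N q cq; split_in N r cr.
have edge x : e f x -> exists c, [/\ centers e c f x, e f c & e c x].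
  by move=> fx; have [c cx] := cs_del sat fx; case: (cx) => cf ? _ _; exists c;
    split; cg.
have tri y1 y2 y3 : e f y1 -> e f y2 -> e f y3 -> e y1 y2 -> e y2 y3 ->
  e y1 y3 -> False.
  move=> f1 f2 f3 e12 e23 e13.
  have only x p q : e f x -> e f p -> e f q -> e x p -> e x q -> p <> q ->
      centers e p f x \/ centers e q f x.
    move=> fx fp fq xp xq pq; have [c [cc fc cx]] := edge _ fx.
    case: (c =P p) => [<-|cp]; [by left|case: (c =P q) => [<-|cq]; [by right|]].
    by case: (@F3 x p q c); cg.
  by apply: (@triangle_centers f y1 y2 y3) => //;
    [exact: D4|exact: D4|exact: D4|..];
    apply: only; cg.
have clq x p q : e f x -> e f p -> e f q -> e x p = false -> e x q = false ->
    p <> q -> x <> p -> x <> q -> e p q.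
  by move=> *; apply: (@claw_adj f x).
have [c fc _] : exists2 y, e f y & y \notin [::] by apply: fresh_nb;
  apply: leq_trans Df.
have [x [z [t [cx fx cx_ fz [ct tx ctA Nc]]]]] := cform _ fc.
have nc y : e f y -> y <> x -> y <> t -> e c y = false.
  by move=> fy yx yt; apply/negP => cy; split_in Nc y cy.
have [y1 f1] : exists2 y, e f y & y \notin [:: c; x; t].
  by apply: fresh_nb; apply: leq_trans Df.
rewrite !inE !negb_or => /and3P[/eqP y1c /eqP y1x /eqP y1t].
have [y2 f2] : exists2 y, e f y & y \notin [:: c; x; t; y1].
  by apply: fresh_nb; apply: leq_trans Df.
rewrite !inE !negb_or => /and4P[/eqP y2c /eqP y2x /eqP y2t /eqP y21].
have n1 := nc _ f1 y1x y1t; have n2 := nc _ f2 y2x y2t.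
have e12 : e y1 y2 by apply: (clq c); cg.
have third y3 : e f y3 -> y3 <> c -> y3 <> x -> y3 <> t -> y3 <> y1 ->
  y3 <> y2 -> False.
  move=> f3 y3c y3x y3t y31 y32; have n3 := nc _ f3 y3x y3t.
  apply: (@tri y1 y2 y3) => //; apply: (clq c); cg.
have [ft|nft] := boolP (e f t); last first.
  have [y3 f3] : exists2 y, e f y & y \notin [:: c; x; y1; y2].
    by apply: fresh_nb; apply: leq_trans Df.
  rewrite !inE !negb_or => /and4P[/eqP ? /eqP ? /eqP ? /eqP ?].
  by apply: (third y3); cg.
have Nf y : e f y -> List.In y [:: c; x; t; y1; y2].
  move=> fy /=; case: (c =P y) => [|yc]; [by auto|].
  case: (x =P y) => [|yx]; [by auto|case: (t =P y) => [|yt]; [by auto|]].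
  case: (y1 =P y) => [|yy1]; [by auto|case: (y2 =P y) => [|yy2]; [by auto 6|]].
  by case: (third y); cg.
have xt : e x t = false by apply/negP => xt; apply: (@tri c x t); cg.
(* N(f) is the 5-cycle c - x - p - q - t; sending each of its vertices v to the
   center of fv would match up the vertices of an odd cycle. *)
have penta p q : e f p -> e f q -> e p q -> e c p = false -> e c q = false ->
    e x p -> e t q -> p <> c -> q <> c -> p <> t -> q <> x -> x <> q -> False.
  move=> fp fq pq cp cq xp tq pc qc pt qx xq.
  have npt : e t p = false.
    by apply/negP => tp; apply: (@tri t p q); cg.
  have nqx : e x q = false.
    by apply/negP => xq_; apply: (@tri x p q); cg.
  have inN s : e f s -> [\/ s = c, s = x, s = t | s = p \/ s = q].
    move=> fs; case: (s =P c) => [|sc]; [by constructor 1|].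
    case: (s =P x) => [|sx]; [by constructor 2|].
    case: (s =P t) => [|st]; [by constructor 3|constructor 4].
    case: (s =P p) => [|sp]; [by left|case: (s =P q) => [|sq]; [by right|]].
    exfalso; apply: (@tri s p q); try cg; apply: (clq c); try cg; exact: nc.
  have two y s s' : e f y -> s <> s' -> centers e y f s -> centers e y f s' ->
    False.
    by move=> fy ss cs cs'; apply: ss; apply: (centers_nb cs' cs); apply: D4.
  have c_t : centers e x f c.
    have [k [kc fk ck]] := edge _ fc.
    have [E|E|E|[E|E]] := inN _ fk; subst k; try cg; try done.
    case: kc => _ _ _ [z' [tz z'f z'c]].
    have Nt : forall y, e t y -> List.In y [:: f; c; q; z].
      case: cx => _ _ _ [z0 [cz0 z0f z0x]].
      have Ez : z0 = z by split_in Nc z0 cz0.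
      subst z0; have [s [cs zs]] := common_nb cz0.
      have Es : s = t by split_in Nc s cs.
      by subst s; apply: nb_all; [uq|uq|exact: D4].
    case: cx => _ _ _ [z0 [cz0 z0f z0x]].
    have Ez : z0 = z by split_in Nc z0 cz0.
    by subst z0; split_in Nt z' tz.
  have c_p : centers e q f p.
    have [k [kc fk ck]] := edge _ fp.
    have [E|E|E|[E|E]] := inN _ fk; subst k; try cg; try done.
    by case: (two x c p); cg.
  have [k [kc fk ck]] := edge _ ft.
  have [E|E|E|[E|E]] := inN _ fk; subst k; try cg.
    by case: (two c x t); cg.
  by case: (two q p t); cg.
have alt y : e f y -> y <> x -> y <> t -> e x y \/ e t y.
  move=> fy yx yt; case xy: (e x y); [by left|right].
  by apply: (clq x); cg.
have F3x := F3 x c y1 y2 fx fc f1 f2.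
have F3t := F3 t c y1 y2 ft fc f1 f2.
case: (alt _ f1 y1x y1t) => [xy1|ty1]; case: (alt _ f2 y2x y2t) => [xy2|ty2].
- by apply: F3x; cg.
- by apply: (@penta y1 y2); cg.
- by apply: (@penta y2 y1); cg.
- by apply: F3t; cg.
Qed.

(** The three neighbours of f other than g and x miss x, so they form a triangle. They also miss g,
    so the edges from f to them are centered within the triangle, against [triangle_centers]. *)
Lemma pair_aux f g x z t : e f g -> e x f -> e x g ->
  (forall y, e x y -> List.In y [:: f; g; z; t]) ->
  e f z = false -> e f t = false -> 5 = deg e f ->
  (forall y, e f y -> y <> g -> deg e y <= 4) -> False.
Proof.
move=> fg xf xg Nx fz ft Df D4.
have [p fp] : exists2 y, e f y & y \notin [:: g; x].
  by apply: fresh_nb; rewrite -Df.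
rewrite !inE !negb_or => /andP[/eqP pg /eqP px].
have [q fq] : exists2 y, e f y & y \notin [:: g; x; p].
  by apply: fresh_nb; rewrite -Df.
rewrite !inE !negb_or => /and3P[/eqP qg /eqP qx /eqP qp].
have [r fr] : exists2 y, e f y & y \notin [:: g; x; p; q].
  by apply: fresh_nb; rewrite -Df.
rewrite !inE !negb_or => /and4P[/eqP rg /eqP rx /eqP rp /eqP rq].
have Nf : forall y, e f y -> List.In y [:: g; x; p; q; r].
  by apply: nb_all; rewrite -?Df //; uq.
have nx y : e f y -> y <> g -> e x y = false.
  by move=> fy yg; apply/negP => xy; split_in Nx y xy.
have K y y' : e f y -> e f y' -> y <> g -> y' <> g -> y <> x -> y' <> x ->
    y <> y' -> e y y'.
  move=> fy fy' yg y'g yx y'x yy'; apply: (@claw_adj f x); try cg; exact: nx.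
have pq : e p q by apply: K; cg.
have qr : e q r by apply: K; cg.
have pr : e p r by apply: K; cg.
have Dp := D4 _ fp pg; have Dq := D4 _ fq qg; have Dr := D4 _ fr rg.
have nog p' q' r' : q' <> g -> r' <> g -> e f p' -> e f q' -> e f r' ->
  e p' q' -> e q' r' -> e p' r' ->
    deg e p' <= 4 -> deg e q' <= 4 -> deg e r' <= 4 ->
    (forall y, e f y -> List.In y [:: g; x; p'; q'; r']) -> e g p' = false.
  move=> q'g r'g fp' fq' fr' pq' qr' pr' Dp' Dq' Dr' Nf'; apply/negP => gp'.
  have Np : forall y, e p' y -> List.In y [:: f; g; q'; r'].
    by apply: nb_all => //; uq.
  have [k [kg kp _ [y [ky yg yp]]]] := cs_del sat gp'.
  have pk : e p' k by cg.
  split_in Np k pk; subst k.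
  - by split_in Nf' y ky.
  - have Nq : forall y, e q' y -> List.In y [:: f; g; p'; r'].
      by apply: nb_all => //; uq.
    by split_in Nq y ky.
  - have Nr : forall y, e r' y -> List.In y [:: f; g; p'; q'].
      by apply: nb_all => //; uq.
    by split_in Nr y ky.
have gp : e g p = false by apply: (nog p q r).
have gq : e g q = false.
  by apply: (nog q p r) => //; try cg; move=> y /Nf /=; tauto.
have gr : e g r = false.
  by apply: (nog r p q) => //; try cg; move=> y /Nf /=; tauto.
have xp := nx _ fp pg; have xq := nx _ fq qg; have xr := nx _ fr rg.
apply: (@triangle_centers f p q r) => //.
- have [k kc] := cs_del sat fp; have [kf kp _ _] := kc.
  have fk : e f k by cg.
  by split_in Nf k fk; subst k; [left|right].
- have [k kc] := cs_del sat fq; have [kf kp _ _] := kc.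
  have fk : e f k by cg.
  by split_in Nf k fk; subst k; [left|right].
- have [k kc] := cs_del sat fr; have [kf kp _ _] := kc.
  have fk : e f k by cg.
  by split_in Nf k fk; subst k; [left|right].
Qed.

(** A center x of fg has exactly two more neighbours z and t. If t misses f or g, [pair_aux]
    applies; otherwise only t could center xz, and N(t) contains no witness. *)
Lemma pair_absurd f g : e f g -> deg e f = 5 -> deg e g = 5 ->
  (forall y, e f y -> y <> g -> deg e y <= 4) ->
  (forall y, e g y -> y <> f -> deg e y <= 4) -> False.
Proof.
move=> fg Df Dg D4f D4g.
have [x [xf xg _ [z [xz zf zg]]]] := cs_del sat fg.
have [t [xt zt]] := common_nb xz.
have Nx : forall y, e x y -> List.In y [:: f; g; z; t].
  by apply: nb_all; [uq|uq|apply: D4f; cg].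
case ft: (e f t); last by apply: (pair_aux fg xf xg Nx _ ft _ D4f); cg.
case gt: (e g t); last first.
  apply: (@pair_aux g f x z t _ _ _ _ _ gt _ D4g) => //; try cg.
  by move=> y /Nx /=; tauto.
have Nt : forall y, e t y -> List.In y [:: f; g; x; z].
  by apply: nb_all; [uq|uq|apply: D4f; cg].
have [k [kx kz _ [y [ky yx yz]]]] := cs_del sat xz.
have xk : e x k by cg.
by split_in Nx k xk; subst k; split_in Nt y ky.
Qed.

(** * The 4-regular case *)

Definition centersb c u v := [&& e c u, e c v, e u v &
  [exists w, [&& e c w, ~~ e w u & ~~ e w v]]].

Lemma centersP c u v : reflect (centers e c u v) (centersb c u v).
Proof.
apply: (iffP and4P) => [[cu cv uv /existsP[w /and3P[cw wu wv]]]|].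
  by split=> //; exists w; split=> //; apply: negbTE.
case=> cu cv uv [w [cw wu wv]]; split=> //; apply/existsP; exists w.
by rewrite cw wu wv.
Qed.

Section FourRegular.
Hypothesis reg4 : forall x y, e x y -> deg e x = 4.

Let le4 x y : e x y -> deg e x <= 4.
Proof. by move/reg4 ->. Qed.

Lemma reg_centers_uniq c f x y : centers e c f x -> centers e c f y -> x = y.
Proof. by move=> cx cy; apply: (centers_nb cy cx); case: cx => /le4. Qed.

(** Applied at the witness w, [neighbour_centers] shows that c also centers an edge at w, so N(c)
    splits into two centered pairs. *)
Lemma reg_nb c f x : centers e c f x -> exists w w',
  [/\ centers e c w w', e w f = false, e w x = false, x <> w'
    & f <> w' /\ forall y, e c y -> List.In y [:: f; x; w; w']].
Proof.
move=> cfx; case: (cfx) => cf cx fx [w [cw wf wx]].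
have D4 : forall y, e w y -> deg e y <= 4 by move=> y wy; apply: (@le4 y w); cg.
have wc : e w c by cg.
have [w' cww] := (neighbour_centers D4).1 _ wc.
have nfw : f <> w'.
  move=> E; subst w'; have E := reg_centers_uniq cfx (centersC cww).
  by subst x; cg.
have nxw : x <> w'.
  move=> E; subst w'; have E := reg_centers_uniq (centersC cfx) (centersC cww).
  by subst f; cg.
exists w, w'; split=> //; split=> //; case: (cww) => _ cw' ww' _.
by apply: nb_all; [uq|uq|apply: le4 cf].
Qed.

(** As w and w' miss f, only x can center cf. If w' centered cx, then xw' could be centered only by
    c, which already centers xf. *)
Lemma reg_rot_aux c f x w w' : centers e c f x -> centers e c w w' ->
  (forall y, e c y -> List.In y [:: f; x; w; w']) ->
  e w f = false -> e w x = false -> e w' f = false ->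
  centers e x c f /\ centers e f c x.
Proof.
move=> cfx cww Nc wf wx w'f; case: (cfx) (cww) => cf cx fx _ [cw cw' ww' _].
split.
  have [k kc] := cs_del sat cf; have [kc' kf _ _] := kc.
  have ck : e c k by cg.
  by split_in Nc k ck; subst k.
have [k kc] := cs_del sat cx; have [kc' kx _ [y [ky yc yx]]] := kc.
have ck : e c k by cg.
split_in Nc k ck.
subst k; exfalso.
have Nw : forall z, e w' z -> List.In z [:: c; x; w; y].
  by apply: nb_all; [uq|uq|apply: le4 ky].
have xw' : e x w' by cg.
have [k kc2] := cs_del sat xw'; have [kx2 kw2 _ _] := kc2.
have wk : e w' k by cg.
split_in Nw k wk; subst k.
by have E := reg_centers_uniq (centersC cfx) kc2; subst w'; cg.
Qed.

(** A witness for c centering ww' is f or x, so w' misses one of them and [reg_rot_aux] applies,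
    after a swap if necessary. *)
Lemma reg_rot c f x : centers e c f x -> centers e x c f /\ centers e f c x.
Proof.
move=> cfx; have [w [w' [cww wf wx xw' [fw' Nc]]]] := reg_nb cfx.
case: (cww) => cw cw' ww' [s [cs sw sw']].
split_in Nc s cs; subst s.
  by apply: (reg_rot_aux cfx cww Nc); cg.
have Nc' : forall y, e c y -> List.In y [:: x; f; w; w'] by move=> y /Nc /=;
  tauto.
have w'x : e w' x = false by cg.
by have [? ?] := reg_rot_aux (centersC cfx) cww Nc' wx wf w'x.
Qed.

(* By [reg_rot] the relation [centers] is symmetric in its three arguments. Each
   vertex lies in exactly two of the resulting triangles, so their number t
   satisfies 3 t = 2 n. *)
Definition tri_sets : {set {set V}} :=
  [set t | [exists c, exists f, exists x,
    centersb c f x && (t == [set c; f; x])]].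

Lemma tri_setsP t : reflect (exists c f x, centers e c f x /\ t = [set c; f; x])
  (t \in tri_sets).
Proof.
rewrite inE; apply: (iffP existsP) =>
  [[c /existsP[f /existsP[x /andP[cfx /eqP ->]]]]|].
  by exists c, f, x; split=> //; apply/centersP.
case=> c [f [x [cfx ->]]]; exists c; apply/existsP; exists f; apply/existsP;
  exists x.
by rewrite eqxx andbT; apply/centersP.
Qed.

Lemma tri_card t : t \in tri_sets -> #|t| = 3.
Proof.
case/tri_setsP=> c [f [x [[cf cx fx _] ->]]].
rewrite -setUA cardsU1 cards2 !inE negb_or.
have -> : c != f by apply/eqP; cg.
have -> : c != x by apply/eqP; cg.
by have -> : f != x by apply/eqP; cg.
Qed.

Lemma tri_at v t : t \in tri_sets -> v \in t ->
  exists f x, centers e v f x /\ t = [set v; f; x].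
Proof.
case/tri_setsP=> c [f [x [cfx ->]]]; rewrite !inE => /orP[/orP[]|] /eqP ->.
- by exists f, x.
- exists c, x; split; first exact: (proj2 (reg_rot cfx)).
  by rewrite [[set c; f]]setUC.
exists c, f; split; first exact: (proj1 (reg_rot cfx)).
by rewrite setUC setUA.
Qed.

Lemma tri_two v y : e v y -> #|[set t in tri_sets | v \in t]| = 2.
Proof.
move=> vy.
have D4 : forall z, e y z -> deg e z <= 4 by move=> z yz; apply: (@le4 z y); cg.
have yv : e y v by cg.
have [x cyx] := (neighbour_centers D4).1 _ yv.
have [w [w' [cww wf wx xw' [fw' Nv]]]] := reg_nb cyx.
have in_tri a b : centers e v a b -> [set v; a; b] \in tri_sets.
  by move=> cab; apply/tri_setsP; exists v, a, b.
have ne : [set v; y; x] != [set v; w; w'].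
  apply/eqP => E; have : w \in [set v; y; x] by rewrite E !inE eqxx orbT.
  case: (cyx) (cww) => vy_ vx yx _ [vw vw' ww _].
  by rewrite !inE => /orP[/orP[]|] /eqP ?; subst w; cg.
have -> : [set t in tri_sets | v \in t] = [set [set v; y; x]; [set v; w; w']].
  apply/setP => t; rewrite inE in_set2.
  apply/idP/idP => [/andP[tT vt]|/orP[]/eqP->]; last 2 first.
  - by rewrite in_tri // !inE eqxx.
  - by rewrite in_tri // !inE eqxx.
  have [f [z [cfz ->]]] := tri_at tT vt; case: (cfz) => vf vz fz _.
  apply/orP; have := Nv f vf => /=; case=> [E|[E|[E|[E|[]]]]]; subst f.
  - by left; rewrite (reg_centers_uniq cfz cyx).
  - left; rewrite (reg_centers_uniq cfz (centersC cyx)).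
    by rewrite -!setUA [[set x; y]]setUC.
  - by right; rewrite (reg_centers_uniq cfz cww).
  - right; rewrite (reg_centers_uniq cfz (centersC cww)).
    by rewrite -!setUA [[set w'; w]]setUC.
by rewrite cards2 ne.
Qed.

Lemma regular_dvd3 : 3 %| #|[set v | 0 < deg e v]|.
Proof.
have E : #|tri_sets| * 3 = #|[set v | 0 < deg e v]| * 2.
  rewrite -!sum_nat_const.
  transitivity (\sum_(t in tri_sets) \sum_v (v \in t)).
    apply: eq_bigr => t /tri_card <-; rewrite -sum1_card big_mkcond.
    by apply: eq_bigr => v _; case: ifP.
  rewrite exchange_big [RHS]big_mkcond; apply: eq_bigr => v _; rewrite inE.
  have -> : \sum_(t in tri_sets) (v \in t) = #|[set t in tri_sets | v \in t]|.
    rewrite -sum1dep_card [RHS]big_mkcondr.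
    by apply: eq_bigr => t _; case: (v \in t).
  case: ifP => [|/negbT]; first by case/(@fresh_nb [::]) => y /tri_two.
  rewrite -eqn0Ngt cards_eq0 => /eqP v0; apply/eqP; rewrite cards_eq0.
  apply/eqP/setP => t; rewrite [RHS]inE inE; apply/negP => /andP[tT vt].
  have [f [x [[vf _ _ _] _]]] := tri_at tT vt.
  by move/setP/(_ f): v0; rewrite !inE vf.
have : 3 %| #|[set v | 0 < deg e v]| * 2 by rewrite -E dvdn_mull.
by rewrite Gauss_dvdl.
Qed.

End FourRegular.

(** * Degree sum without isolated vertices *)

Lemma sum_eq1 (a : V) : \sum_v (v == a) = 1.
Proof. by rewrite (bigD1 a) //= eqxx big1 // => v /negbTE ->. Qed.

Lemma low_charge v : simplicial e v -> deg e v < 4 -> charge v = deg e v.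
Proof.
move=> sv D; rewrite charge_small ?(leq_trans D) //.
have /negbTE N : ~~ nonsimp v by apply/nonsimpP; apply.
by rewrite /tip N andbF addn0.
Qed.

Lemma center_nonsimp c x y : centers e c x y -> ~ simplicial e c.
Proof. by move=> cc sc; apply: simplicial_center sc cc. Qed.

(** Only simplicial vertices of degree at most 3 fall short of charge 4, and they are pairwise
    adjacent. Such a vertex u has two nonsimplicial neighbours c and v, found as centers. When the
    total deficit could be 2, [mutual_extra] supplies a vertex with surplus. *)
Lemma deg_sum_min2 : (forall v, exists y, e v y) ->
  4 * #|V| <= (\sum_v deg e v).+1.
Proof.
move=> noiso; rewrite -sum_charge.
have <- : \sum_(v : V) 4 = 4 * #|V| by rewrite sum_nat_const mulnC.
case low: [exists u, ~~ nonsimp u && (deg e u < 4)]; last first.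
  apply: leqW; apply: leq_sum => v _.
  have /existsPn/(_ v) := negbT low; rewrite negb_and negbK -leqNgt.
  by case/orP; [exact: nonsimp_charge|exact: charge_ge4].
have /existsP[u /andP[/nonsimpPn su Du]] := low.
have high v : e u v = false -> v <> u -> 4 <= charge v.
  move=> uv vu.
  have [N|/nonsimpPn sv] := boolP (nonsimp v); first exact: nonsimp_charge.
  case: (leqP 4 (deg e v)) => [|D]; first exact: charge_ge4.
  have uv_ : e u v by apply: simplicial_adj => //; cg.
  cg.
have nonsimpE v : ~ simplicial e v -> 4 <= charge v.
  by move=> ns; apply: nonsimp_charge; apply/nonsimpP.
have [s us] := noiso u; have [c cus] := cs_del sat us.
have [cu _ _ _] := cus; have uc : e u c by cg.
have nsc := center_nonsimp cus.
have [v vuc] := cs_del sat uc; have [vu vc _ _] := vuc.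
have nsv := center_nonsimp vuc; have uv : e u v by cg.
have [c' cuv] := cs_del sat uv; have [cu' cv' _ _] := cuv.
have nsc' := center_nonsimp cuv; have uc' : e u c' by cg.
have chu := low_charge su Du.
have extra : centers e c u v ->
    (forall r, e u r -> r <> v -> r <> c -> simplicial e r) -> exists d,
      5 <= charge d.
  by move=> cuv' rest; apply: (mutual_extra su vuc).
have [Du3|Du3] := ltnP 2 (deg e u); last first.
  have Nu : forall y, e u y -> List.In y [:: v; c] by apply: nb_all; [uq|uq|].
  have [|r ur rv rc|d cd] := extra.
  - by split_in Nu c' uc'; subst c'.
  - by split_in Nu r ur.
  have D2 : 2 <= deg e u by apply: (@deg_ge [:: v; c]); uq.
  (* u lacks at most two units, and d returns one. *)
  have : \sum_(x : V) (4 + (x == d)) <= \sum_x (charge x + ((x == u) + (x ==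
    u))).
    apply: leq_sum => x _; case: (x =P u) => [->|xu].
      have -> : (u == d) = false by apply/eqP => E; subst d; move: cd Du;
        rewrite chu; clear; lia.
      by rewrite chu; move: D2; clear; lia.
    case: (x =P d) => [->|_]; first by rewrite addn0.
    rewrite !addn0; case ux: (e u x); last exact: high.
    by split_in Nu x ux; subst x; apply: nonsimpE.
  rewrite !big_split /= !sum_eq1; clear; lia.
have [r ur] : exists2 y, e u y & y \notin [:: v; c] by exact: fresh_nb.
rewrite !inE !negb_or => /andP[/eqP rv /eqP rc].
have Nu : forall y, e u y -> List.In y [:: v; c; r] by apply: nb_all; [uq|uq|].
have cu3 : charge u = 3 by rewrite chu; move: Du Du3; clear; lia.
have [nsr|/nonsimpPn sr] := boolP (nonsimp r).
  have : \sum_(x : V) 4 <= \sum_x (charge x + (x == u)).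
    apply: leq_sum => x _; case: (x =P u) => [->|xu]; first by rewrite cu3.
    rewrite addn0; case ux: (e u x); last exact: high.
    by split_in Nu x ux; subst x;
      [exact: nonsimpE|exact: nonsimpE|exact: nonsimp_charge].
  rewrite !big_split /= !sum_eq1; clear; lia.
have [|r' ur' rv' rc'|d cd] := extra.
- by split_in Nu c' uc'; subst c'; rewrite ?sr.
- by split_in Nu r' ur'; subst r'.
have rv_ : e r v by apply: su; cg.
have rc_ : e r c by apply: su; cg.
have D3 : 3 <= deg e r by apply: (@deg_ge [:: u; v; c]); uq.
have cr : 3 <= charge r.
  case: (leqP 4 (deg e r)) => D; first exact: leq_trans (charge_ge4 D).
  by rewrite low_charge.
(* u and r lack at most one unit each, and d returns one. *)
have : \sum_(x : V) (4 + (x == d)) <= \sum_x (charge x + (x == u) + (x == r)).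
  apply: leq_sum => x _; case: (x =P d) => [->|xd].
    by rewrite addn1 -addnA; apply: leq_trans cd (leq_addr _ _).
  case: (x =P u) => [->|xu]; first by rewrite cu3.
  case: (x =P r) => [->|xr]; first by move: cr; clear; lia.
  rewrite !addn0; case ux: (e u x); last exact: high.
  by split_in Nu x ux; subst x; apply: nonsimpE.
rewrite !big_split /= !sum_eq1; clear; lia.
Qed.

(** * Graphs with an isolated vertex *)

Section Isolated.
Variable i : V.
Hypothesis iso : forall y, e i y = false.

Lemma iso_simplicial : simplicial e i.
Proof. by move=> a b; rewrite iso. Qed.

Lemma other_nonsimp v : v <> i -> nonsimp v.
Proof.
move=> vi; apply: contraT => /nonsimpP ns; exfalso; apply: ns => sv.
have := simplicial_adj iso_simplicial sv.
by rewrite iso => /(_ _) H; apply: notF; apply: H => E; subst v.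
Qed.

Lemma iso_deg : deg e i = 0.
Proof. by apply/eqP; rewrite cards_eq0; apply/eqP/setP => y;
  rewrite !inE iso. Qed.

Lemma iso_charge : charge i = 0.
Proof.
have D := iso_deg; by rewrite low_charge ?D //; exact: iso_simplicial.
Qed.

Lemma other_charge v : v <> i -> 4 <= charge v.
Proof. by move/other_nonsimp/nonsimp_charge. Qed.

Lemma sum_others : \sum_(v : V) 4 * (v != i) = 4 * #|V|.-1.
Proof.
rewrite (bigD1 i) //= eqxx muln0 add0n.
rewrite (eq_bigr (fun=> 4)) => [|v /negbTE ->]; last by rewrite muln1.
by rewrite sum_nat_const cardC1 mulnC.
Qed.

Lemma deg_sum_isolated : 4 * #|V|.-1 <= \sum_v deg e v.
Proof.
rewrite -sum_charge -sum_others; apply: leq_sum => v _.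
by case: eqP => [|/other_charge]; rewrite ?muln0 ?muln1.
Qed.

Lemma excess_sum : excess3 -> 4 * #|V|.-1 + 3 <= \sum_v deg e v.
Proof.
case=> x [y [z ex]]; rewrite -sum_charge -sum_others.
have : \sum_v (4 * (v != i) + ((v == x) + (v == y) + (v == z))) <= \sum_v
  charge v.
  apply: leq_sum => v _; have := ex v.
  by case: (v =P i) => [->|/other_charge]; rewrite ?iso_charge; lia.
by rewrite !big_split /= !sum_eq1.
Qed.

(** Without tips there are no midpoints, so charge is degree. A vertex of degree at least 5 has a
    neighbour of degree at least 5 by [lonely_absurd]; if the total surplus stays below 3, these two
    are the situation of [pair_absurd]. *)
Lemma no_excess_regular : ~ excess3 -> forall x y, e x y -> deg e x = 4.
Proof.
move=> nex.
have notip u : tip u = false by apply/negP => /tip_excess.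
have nomid b : mid b = false.
  case M: (mid b) => //; have [u [a [c [w [w' /spike_tip]]]]] := mid_spike M.
  by rewrite notip.
have D4 v : v <> i -> 4 <= deg e v.
  by move=> /other_charge; rewrite /charge notip nomid addn0 subn0.
have chargeE v : charge v = deg e v by rewrite /charge notip nomid addn0 subn0.
have di x y : e x y -> x <> i by move=> xy E; subst x; rewrite iso in xy.
move=> f y0 fy0; apply/eqP; rewrite eqn_leq D4 ?andbT; last exact: di fy0.
rewrite leqNgt; apply/negP => Df.
case hi: [exists g, e f g && (4 < deg e g)]; last first.
  apply: (lonely_absurd Df) => y fy; rewrite leqNgt; apply/negP => Dy.
  by case/negP: (negbT hi); apply/existsP; exists y; rewrite fy.
have /existsP[g /andP[fg Dg]] := hi; apply: nex.
have fNg : f <> g by cg.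
case: (ltnP 5 (deg e f)) => [Df6|Df6]; first by apply: (excess21 fNg);
  rewrite chargeE.
case: (ltnP 5 (deg e g)) => [Dg6|Dg6].
  by apply: (@excess21 g f); rewrite ?chargeE //; cg.
case hi3: [exists k, [&& k != f, k != g & 4 < deg e k]].
  have /existsP[k /and3P[/eqP kf /eqP kg Dk]] := hi3.
  by apply: (@excess111 f g k); rewrite ?chargeE //; cg.
have small k : k <> f -> k <> g -> deg e k <= 4.
  move=> kf kg; rewrite leqNgt; apply/negP => Dk.
  case/negP: (negbT hi3); apply/existsP; exists k; rewrite Dk andbT.
  by apply/andP; split; apply/eqP.
exfalso; apply: (pair_absurd fg).
- by apply/eqP; rewrite eqn_leq Df6.
- by apply/eqP; rewrite eqn_leq Dg6.
- by move=> y fy yg; apply: small; cg.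
- by move=> y gy yf; apply: small; cg.
Qed.

Lemma deg_sum_isolated_mod : ~~ (3 %| #|V|.-1) ->
  4 * #|V|.-1 + 3 <= \sum_v deg e v.
Proof.
move=> n3; rewrite leqNgt; apply/negP => lt.
have nex : ~ excess3 by move=> /excess_sum; rewrite leqNgt lt.
have := regular_dvd3 (no_excess_regular nex); apply/negP.
suff -> : #|[set v | 0 < deg e v]| = #|V|.-1 by [].
rewrite -(cardC1 i); apply: eq_card => v; rewrite !inE.
have [->|/eqP vi] := eqVneq v i.
  by rewrite iso_deg.
by have := nonsimp_deg (other_nonsimp vi); case: (deg e v).
Qed.

End Isolated.

End LowerBound.

(** * Constructions *)

Section DisjointUnion.
Variables (a b : nat) (e1 : rel 'I_a) (e2 : rel 'I_b).

Definition union_rel : rel 'I_(a + b) := fun x y =>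
  match split x, split y with
  | inl x, inl y => e1 x y
  | inr x, inr y => e2 x y
  | _, _ => false
  end.

Lemma union_l x y : union_rel (lshift b x) (lshift b y) = e1 x y.
Proof. by rewrite /union_rel !(unsplitK (inl _)). Qed.
Lemma union_r x y : union_rel (rshift a x) (rshift a y) = e2 x y.
Proof. by rewrite /union_rel !(unsplitK (inr _)). Qed.
Lemma union_lr x y : union_rel (lshift b x) (rshift a y) = false.
Proof. by rewrite /union_rel (unsplitK (inl x)) (unsplitK (inr y)). Qed.
Lemma union_rl x y : union_rel (rshift a x) (lshift b y) = false.
Proof. by rewrite /union_rel (unsplitK (inl y)) (unsplitK (inr x)). Qed.

Definition unionE := (union_l, union_r, union_lr, union_rl).

Lemma union_sum_deg :
  \sum_x deg union_rel x = \sum_x deg e1 x + \sum_x deg e2 x.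
Proof.
have degE (V : finType) (e : rel V) x : deg e x = \sum_y e x y.
  by rewrite /deg -sum1dep_card big_mkcond; apply: eq_bigr => y _;
    case: (e x y).
rewrite big_split_ord /=; congr (_ + _); apply: eq_bigr => x _.
  rewrite !degE big_split_ord /= [X in _ + X]big1 ?addn0 => [|y _];
    last by rewrite unionE.
  by apply: eq_bigr => y _; rewrite unionE.
rewrite !degE big_split_ord /= [X in X + _]big1 ?add0n => [|y _];
  last by rewrite unionE.
by apply: eq_bigr => y _; rewrite unionE.
Qed.

Ltac ordsplit x := let y := fresh x in
  case: (split_ordP x) => y ?; subst x; rename y into x.

(** An edge added across the parts creates a claw at its endpoint in the first part, which has two
    nonadjacent neighbours. The second part may therefore be a single vertex. *)
Lemma union_saturated : claw_saturated e1 -> claw_saturated e2 ->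
  (forall x, nonsimp e1 x) -> claw_saturated union_rel.
Proof.
move=> [sym1 irr1 free1 del1 add1] [sym2 irr2 free2 del2 add2] ns; split.
- by move=> x y; ordsplit x; ordsplit y; rewrite !unionE.
- by move=> x; ordsplit x; rewrite !unionE.
- move=> c x y z [[cx cy cz [xy yz xz]] [nxy nyz nxz]].
  move: cx cy cz xy yz xz nxy nyz nxz.
  ordsplit c; ordsplit x; ordsplit y; ordsplit z; rewrite !unionE //.
    move=> cx cy cz xy yz xz nxy nyz nxz; apply: (free1 c x y z).
    by split; split=> //; split=> E; [apply: xy|apply: yz|apply: xz]; rewrite E.
  move=> cx cy cz xy yz xz nxy nyz nxz; apply: (free2 c x y z).
  by split; split=> //; split=> E; [apply: xy|apply: yz|apply: xz]; rewrite E.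
- move=> x y; ordsplit x; ordsplit y; rewrite !unionE // => xy.
    have [c [cx cy _ [w [cw wx wy]]]] := del1 _ _ xy.
    exists (lshift b c); split; rewrite ?unionE //.
    by exists (lshift b w); rewrite !unionE.
  have [c [cx cy _ [w [cw wx wy]]]] := del2 _ _ xy.
  exists (rshift a c); split; rewrite ?unionE //.
  by exists (rshift a w); rewrite !unionE.
have far x y : spread union_rel (lshift b x) (rshift a y).
  have /existsP[p /existsP[q /and4P[xp xq pq npq]]] := ns x.
  exists (lshift b p), (lshift b q); rewrite !unionE; split=> //;
    last exact: negbTE.
  by move/lshift_inj=> E; rewrite E eqxx in pq.
have sp1 x y : spread e1 x y -> spread union_rel (lshift b x) (lshift b y).
  case=> p [q [xp xq pq npq [yp yq]]].
  exists (lshift b p), (lshift b q); rewrite !unionE; split=> //.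
  by move/lshift_inj.
have sp2 x y : spread e2 x y -> spread union_rel (rshift a x) (rshift a y).
  case=> p [q [xp xq pq npq [yp yq]]].
  exists (rshift a p), (rshift a q); rewrite !unionE; split=> //.
  by move/rshift_inj.
move=> x y; ordsplit x; ordsplit y; rewrite !unionE => xy nxy.
- have xy' : x <> y by move=> E; apply: xy; rewrite E.
  by case: (add1 _ _ xy' nxy) => /sp1; auto.
- by left.
- by right.
- have xy' : x <> y by move=> E; apply: xy; rewrite E.
  by case: (add2 _ _ xy' nxy) => /sp2; auto.
Qed.

Lemma union_nonsimp : (forall x, nonsimp e1 x) -> (forall x, nonsimp e2 x) ->
  forall x, nonsimp union_rel x.
Proof.
move=> ns1 ns2 x; ordsplit x.
  have /existsP[p /existsP[q pq]] := ns1 x.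
  apply/existsP; exists (lshift b p); apply/existsP; exists (lshift b q).
  by rewrite !unionE (inj_eq (@lshift_inj _ _)).
have /existsP[p /existsP[q pq]] := ns2 x.
apply/existsP; exists (rshift a p); apply/existsP; exists (rshift a q).
by rewrite !unionE (inj_eq (@rshift_inj _ _)).
Qed.

End DisjointUnion.

(** * Line graphs *)

Section LineGraph.
Variable H : seq (nat * nat).

Definition meet_edges (p q : nat * nat) :=
  (p != q) && [|| p.1 == q.1, p.1 == q.2, p.2 == q.1 | p.2 == q.2].

Definition line_rel : rel 'I_(size H) := fun i j =>
  meet_edges (nth (0, 0) H i) (nth (0, 0) H j).

(* The conditions of [claw_saturated] and [nonsimp], with all quantifiers
   ranging over the list [H] so that they evaluate. *)
Definition line_check : bool :=
  let e := meet_edges in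
  [&& uniq H,
   all (fun c => all (fun x => e c x ==> all (fun y => e c y && (x != y) &&
     ~~ e x y ==>
      all (fun z => [&& e c z, y != z, x != z, ~~ e y z & ~~ e x z] ==>
        false) H) H) H) H,
   all (fun u => all (fun v => e u v ==>
      has (fun c => [&& e c u, e c v & has (fun w => [&& e c w, ~~ e w u &
        ~~ e w v]) H]) H) H) H,
   all (fun u => all (fun v => (u != v) && ~~ e u v ==>
      let sp u v := has (fun a => e u a && ~~ e v a && has (fun b =>
                     [&& e u b, a != b, ~~ e a b & ~~ e v b]) H) H in
      sp u v || sp v u) H) H &
   all (fun u => has (fun a => e u a && has (fun b => [&& e u b, a != b &
     ~~ e a b]) H) H) H].

(** The degree sum of the line graph, which is twice its number of edges. *)
Definition line_size : nat :=
  sumn [seq count (meet_edges p) H | p <- H].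

Lemma meet_sym p q : meet_edges p q = meet_edges q p.
Proof.
rewrite /meet_edges (eq_sym p) (eq_sym p.1 q.1) (eq_sym p.1 q.2) (eq_sym p.2
  q.1).
rewrite (eq_sym p.2 q.2); congr (_ && _).
by case: (_ == _) (_ == _) (_ == _) => [] [] [].
Qed.

Let h (i : 'I_(size H)) := nth (0, 0) H i.

Lemma line_sum_deg : \sum_i deg line_rel i = line_size.
Proof.
rewrite /line_size sumnE big_map (big_nth (0, 0)) big_mkord; apply: eq_bigr =>
  i _.
rewrite /deg -sum1dep_card -sum1_count (big_nth (0, 0)) big_mkord.
by [].
Qed.

Lemma line_checkP : line_check ->
  claw_saturated line_rel /\ (forall i, nonsimp line_rel i).
Proof.
case/and5P=> U free del add ns.
have hH i : h i \in H by apply: mem_nth.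
have hI : injective h.
  by move=> i j /eqP; rewrite nth_uniq // => /eqP/val_inj.
have hneq i j : i <> j -> h i != h j by move=> ij; apply/eqP => /hI.
have ex p : p \in H -> exists i, h i = p.
  move=> pH; have lt : index p H < size H by rewrite index_mem.
  by exists (Ordinal lt); apply: nth_index.
have lE i j : line_rel i j = meet_edges (h i) (h j) by [].
split; last first.
  move=> i; have /hasP[_ /ex[a <-] /andP[ia /hasP[_ /ex[b <-] /and3P[ib ab
    nab]]]] :=
    allP ns _ (hH i).
  apply/existsP; exists a; apply/existsP; exists b.
  by rewrite !lE ia ib nab andbT /=; apply/eqP => E; rewrite E eqxx in ab.
split.
- by move=> i j; rewrite !lE meet_sym.
- by move=> i; rewrite lE /meet_edges eqxx.
- move=> c x y z [[cx cy cz [xy yz xz]] [nxy nyz nxz]].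
  have := allP (allP free _ (hH c)) _ (hH x); rewrite -lE cx =>
    /allP/(_ _ (hH y)).
  rewrite -!lE cy nxy hneq //= => /allP/(_ _ (hH z)).
  by rewrite -!lE cz nyz nxz !hneq.
- move=> u v uv; have := allP (allP del _ (hH u)) _ (hH v); rewrite -lE uv.
  move=> /hasP[_ /ex[c <-] /and3P[cu cv /hasP[_ /ex[w <-] /and3P[cw wu wv]]]].
  by exists c; split=> //; exists w; split=> //; apply: negbTE.
move=> u v uv nuv; have := allP (allP add _ (hH u)) _ (hH v).
rewrite -lE nuv hneq //=.
have sp x y : has (fun a => meet_edges (h x) a && ~~ meet_edges (h y) a &&
  has (fun b =>
    [&& meet_edges (h x) b, a != b, ~~ meet_edges a b &
      ~~ meet_edges (h y) b]) H) H ->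
    spread line_rel x y.
  move=> /hasP[_ /ex[a <-] /andP[/andP[xa ya] /hasP[_ /ex[b <-] /and4P[xb ab
    nab yb]]]].
  exists a, b; split=> //; try exact: negbTE; last by split; apply: negbTE.
  by move=> E; rewrite E eqxx in ab.
by case/orP=> /sp; auto.
Qed.

End LineGraph.

(** * Components and the orders they reach *)

(** The cycle on 2m vertices with its m long diagonals. For m at least 3 it is cubic and
    triangle-free, so its line graph is 4-regular on 3m vertices. *)
Definition mobius_ladder m :=
  [seq (i, i.+1 %% (2 * m)) | i <- iota 0 (2 * m)] ++ [seq (i,
    i + m) | i <- iota 0 m].

(* Six vertices of degree 3 and one of degree 4, whence a line graph with 11
   vertices and 6 * 3 + 6 = 24 edges. *)
Definition seven_graph :=
  [:: (3, 4); (3, 5); (2, 6); (1, 6); (1, 4); (0, 4); (1, 5); (2, 3); (0, 3);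
    (0, 2); (5, 6)].

(** The number s is twice the number of edges; nonsimpliciality is carried along so that components
    can be combined. *)
Definition saturated_with n s := exists e : rel 'I_n,
  [/\ claw_saturated e, forall x, nonsimp e x & \sum_x deg e x = s].

Lemma line_saturated_with H : line_check H ->
  saturated_with (size H) (line_size H).
Proof.
by move/line_checkP=> [sat ns]; exists (@line_rel H); split=> //;
  apply: line_sum_deg.
Qed.

Lemma saturated_with9 : saturated_with 9 36.
Proof. by have := @line_saturated_with (mobius_ladder 3); apply;
  vm_compute. Qed.
Lemma saturated_with12 : saturated_with 12 48.
Proof. by have := @line_saturated_with (mobius_ladder 4); apply;
  vm_compute. Qed.
Lemma saturated_with15 : saturated_with 15 60.
Proof. by have := @line_saturated_with (mobius_ladder 5); apply;
  vm_compute. Qed.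
Lemma saturated_with11 : saturated_with 11 48.
Proof. by have := @line_saturated_with seven_graph; apply; vm_compute. Qed.

Lemma saturated_withD n m s t : saturated_with n s -> saturated_with m t ->
  saturated_with (n + m) (s + t).
Proof.
move=> [e1 [sat1 ns1 d1]] [e2 [sat2 ns2 d2]]; exists (union_rel e1 e2); split.
- exact: union_saturated.
- exact: union_nonsimp.
- by rewrite union_sum_deg d1 d2.
Qed.

(** Orders 9, 12 and 15 are the base, and adding the component of order 9 reaches every later
    multiple of 3. *)
Lemma saturated_with_mod0 k : 3 <= k -> saturated_with (3 * k) (12 * k).
Proof.
elim/ltn_ind: k => k IH k3.
have [k6|k6] := leqP 6 k.
  have -> : 3 * k = 9 + 3 * (k - 3) by lia.
  have -> : 12 * k = 36 + 12 * (k - 3) by lia.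
  by apply: saturated_withD saturated_with9 _; apply: IH; lia.
have [->|->|->] : [\/ k = 3, k = 4 | k = 5] by case: k k3 k6 {IH} =>
  [|[|[|[|[|[|]]]]]] //; auto; constructor.
- exact: saturated_with9.
- exact: saturated_with12.
- exact: saturated_with15.
Qed.

(** One component of order 11 leaves n - 11 vertices, a multiple of 3 that must be 0 or at least 9;
    this excludes 14 and 17. *)
Lemma saturated_with_mod2 n : 9 <= n -> n <> 14 -> n <> 17 -> n %% 3 = 2 ->
  saturated_with n (4 * n + 4).
Proof.
move=> n9 n14 n17 n2.
have [->|n11] := eqVneq n 11; first exact: saturated_with11.
have -> : n = 11 + 3 * ((n - 11) %/ 3) by lia.
have -> : 4 * (11 + 3 * ((n - 11) %/ 3)) + 4 = 48 + 12 * ((n - 11) %/ 3) by lia.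
apply: saturated_withD saturated_with11 _; apply: saturated_with_mod0; lia.
Qed.

Lemma saturated_isolated n s : saturated_with n s ->
  exists e : rel 'I_(n + 1), claw_saturated e /\ \sum_x deg e x = s.
Proof.
case=> e [sat ns d]; pose e0 : rel 'I_1 := fun _ _ => false.
exists (union_rel e e0); split; last first.
  rewrite union_sum_deg d [X in _ + X]big1 ?addn0 // => x _.
  by apply/eqP; rewrite cards_eq0; apply/eqP/setP => y; rewrite !inE.
apply: union_saturated => //; split=> //.
- by move=> c x y z [[]].
- by move=> u v uv; case: uv; rewrite (ord1 u) (ord1 v).
Qed.

(** * Bounds on the number of edges *)

Lemma graph_saturated n (e : rel 'I_n) s : claw_saturated e ->
  \sum_x deg e x = 2 * s ->
  exists2 G : sgraph 'I_n, induced_saturated K13 G & #|edges G| = s.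
Proof.
move=> sat d; have [sym irr free del add] := sat.
have E := adj_graph_of sym irr.
exists (graph_of e); last first.
  apply/eqP; rewrite -(eqn_pmul2l (m := 2)) // -sum_deg -d; apply/eqP.
  by apply: eq_bigr => x _; apply: eq_card => y; rewrite !inE E.
apply/induced_saturatedP; split.
- exact: adjC.
- exact: adjxx.
- move=> c x y z [[cx cy cz N] [n1 n2 n3]]; apply: (free c x y z).
  by rewrite !E in cx cy cz n1 n2 n3; split.
- move=> u v; rewrite E => /del[c [cu cv uv [w [cw wu wv]]]].
  by exists c; split; rewrite ?E //; exists w; rewrite !E.
move=> u v uv; rewrite E => nuv.
by case: (add _ _ uv nuv) => -[a [b [ua ub ab nab [va vb]]]]; [left|right];
  exists a, b; rewrite !E; split.
Qed.

(** The degree sum is even, so the lower bound 4n - 1 given by [deg_sum_min2] and by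
    [deg_sum_isolated_mod] rounds up to 4n, that is 2n edges. *)
Lemma edges_lower n (G : sgraph 'I_n) : induced_saturated K13 G ->
  2 * n - 2 <= #|edges G| /\ (n %% 3 <> 1 -> 2 * n <= #|edges G|).
Proof.
move=> /induced_saturatedP sat; have sum := sum_deg G.
case iso: [exists i, [forall y, ~~ adj G i y]].
  have /existsP[i /forallP iP] := iso.
  have {}iP y : adj G i y = false by apply/negbTE.
  have n0 : 0 < n by apply: leq_ltn_trans (ltn_ord i).
  have l1 := deg_sum_isolated sat iP; have l2 := deg_sum_isolated_mod sat iP.
  rewrite sum card_ord in l1 l2; split; first by move: l1; clear -n0; lia.
  move=> n3; have /l2 : ~~ (3 %| n.-1) by apply/negP; move: n3; clear -n0; lia.
  by clear -n0; lia.
have noiso v : exists y, adj G v y.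
  have /existsPn/(_ v)/forallPn[y] := negbT iso; rewrite negbK => vy;
    by exists y.
have := deg_sum_min2 sat noiso; rewrite sum card_ord; clear; lia.
Qed.

(** The three values belong to a 4-regular graph, to one with an isolated vertex added, and to a
    graph with the component of order 11, which has two edges more than twice its order. *)
Lemma exists_saturated n : 9 <= n -> n <> 14 -> n <> 17 ->
  exists2 G : sgraph 'I_n, induced_saturated K13 G
    & #|edges G| = nth 0 [:: 2 * n; 2 * n - 2; 2 * n + 2] (n %% 3).
Proof.
move=> n9 n14 n17.
have n3 : [\/ n %% 3 = 0, n %% 3 = 1 | n %% 3 = 2].
  by have := ltn_pmod n (isT : 0 < 3); case: (n %% 3) => [|[|[|]]] // _;
    constructor.
case: n3 => n3; rewrite n3 /=.
- have [|e [sat _ d]] := @saturated_with_mod0 (n %/ 3); first by lia.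
  have nE : 3 * (n %/ 3) = n by lia.
  by rewrite nE in e sat d; apply: (graph_saturated sat); rewrite d; lia.
- have [|e [sat d]] := saturated_isolated (@saturated_with_mod0 (n %/ 3) _);
  first by lia.
  have nE : 3 * (n %/ 3) + 1 = n by lia.
  by rewrite nE in e sat d; apply: (graph_saturated sat); rewrite d; lia.
- have [e [sat _ d]] := saturated_with_mod2 n9 n14 n17 n3.
  by apply: (graph_saturated sat); rewrite d; lia.
Qed.

Theorem theorem4p1 (n : nat) (n_ge9 : 9 <= n) (n_neq14 : n <> 14)
    (n_neq17 : n <> 17) :
  (exists G : sgraph 'I_n, induced_saturated K13 G) /\
  [/\ n = 0 %[mod 3] -> sis n K13 = 2 * n,
      n = 1 %[mod 3] -> sis n K13 = 2 * n - 2
    & n = 2 %[mod 3] -> 2 * n <= sis n K13 <= 2 * n + 2].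
Proof.
have [G satG cardG] := exists_saturated n_ge9 n_neq14 n_neq17.
have ex : exists G : sgraph 'I_n, induced_saturated K13 G by exists G.
split=> //; have [[G' satG' <-] le_sis] := sisP ex.
have [lo1 lo2] := edges_lower satG'; have := le_sis _ satG; rewrite cardG => up.
split=> n3.
- have {}n3 : n %% 3 = 0 := n3; have /lo2 lo : n %% 3 <> 1 by rewrite n3.
  by apply/eqP; rewrite n3 /= in up; rewrite eqn_leq up lo.
- have {}n3 : n %% 3 = 1 := n3.
  by apply/eqP; rewrite n3 /= in up; rewrite eqn_leq up lo1.
have {}n3 : n %% 3 = 2 := n3; have /lo2 lo : n %% 3 <> 1 by rewrite n3.
by rewrite n3 /= in up; rewrite lo up.
Qed.
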